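(* Let $(\phi,\xi,\eta,g)$ be an almost contact metric structure on a contact manifold $(M,\eta)$ of dimension at least $3$, and let $D=\ker\eta$. Suppose that $$d\eta(\phi X,\phi Y)=-d\eta(X,Y)\quad\text{for all } X,Y\in D,$$ or equivalently that $B\phi+\phi B=0$ on $D$, where $B:D\to D$ is the skew-symmetric part of $A|_D$, with $A=\nabla\xi$. Then $\dim M=4n+1$ for some integer $n\geq 1$, and $B:D\to D$ is a bundle automorphism.
   Context: A contact manifold $(M,\eta)$ is a smooth manifold of odd dimension $2m+1$ with a $1$-form $\eta$ such that $\eta\wedge(d\eta)^m\neq 0$ everywhere. Its contact distribution is $D=\ker\eta\subset TM$; $X\in D$ means that $X$ is a section of $D$. An almost contact metric structure $(\phi,\xi,\eta,g)$ on $M$ consists of a $(1,1)$-tensor field $\phi$, a vector field $\xi$, a $1$-form $\eta$ and a Riemannian metric $g$ with $\phi^2=-I+\eta\otimes\xi$, $\eta(\xi)=1$ and $g(\phi X,\phi Y)=g(X,Y)-\eta(X)\eta(Y)$ for all $X,Y$. It is not assumed that $d\eta(X,Y)=g(X,\phi Y)$, nor that $\xi$ is the Reeb vector field of $\eta$. Let $\nabla$ be the Levi-Civita connection of $g$ and $A=\nabla\xi:TM\to TM$, $X\mapsto\nabla_X\xi$. Since $\xi$ has unit length, $A$ takes values in $D$. Put $B=\frac12(A|_D-A^* )$, where $A^*$ is the adjoint of $A|_D:D\to D$ with respect to $g|_{D\times D}$. The convention for the exterior derivative is $2\,d\eta(X,Y)=X(\eta(Y))-Y(\eta(X))-\eta([X,Y])$,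 so that $d\eta(X,Y)=g(BX,Y)$ for $X,Y\in D$. *)

(* Defs.v *)
From mathcomp Require Import all_boot all_order all_fingroup all_algebra.
From mathcomp Require Import all_classical all_reals all_analysis.
From mathcomp Require Import ring.

Set Implicit Arguments.
Unset Strict Implicit.
Unset Printing Implicit Defensive.

Import Order.TTheory GRing.Theory Num.Theory.
Import numFieldNormedType.Exports.

Local Open Scope classical_set_scope.
Local Open Scope ring_scope.

Section Calculus.
Context {R : realType} {d : nat}.

Definition partial (i : 'I_d) (f : 'rV[R]_d -> R) : 'rV[R]_d -> R :=
  fun x => 'D_(delta_mx 0 i) f x.

(* All iterated partial derivatives are differentiable at every point of U;
   for U open this is the usual notion of a C^oo function on U. *)
Definition smooth_on (U : set 'rV[R]_d) (f : 'rV[R]_d -> R) : Prop :=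
  forall (s : seq 'I_d) (x : 'rV[R]_d), U x ->
    differentiable (foldr partial f s) x.

End Calculus.

(* Manifolds are nonempty, Hausdorff and second countable; they need not be
   connected. The atlas need not be maximal. [cmap c] and [cinv c] are only
   meaningful on [cdom c] and on its image. *)
Record manifold (R : realType) (d : nat) := Manifold {
  carrier :> topologicalType ;
  manifold_nonempty : exists p : carrier, True ;
  manifold_hausdorff : hausdorff_space carrier ;
  manifold_second_countable : @second_countable carrier ;
  chart : Type ;
  cdom : chart -> set carrier ;
  cmap : chart -> carrier -> 'rV[R]_d ;
  cinv : chart -> 'rV[R]_d -> carrier ;
  cdom_cover : forall p, exists c, cdom c p ;
  cdom_open : forall c, open (cdom c) ;
  cmap_open : forall c, open (cmap c @` cdom c) ;
  cmapK : forall c p, cdom c p -> cinv c (cmap c p) = p ;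
  cmap_continuous : forall c p, cdom c p -> {for p, continuous (cmap c)} ;
  cinv_continuous : forall c p, cdom c p ->
    {for cmap c p, continuous (cinv c)} ;
  chart_compatible : forall (c c' : chart) (j : 'I_d),
    smooth_on (cmap c @` (cdom c `&` cdom c')) (fun x => cmap c' (cinv c x) 0 j)
}.

Section Tensors.
Context {R : realType} {d : nat} {M : manifold R d}.

Definition smooth (c : chart M) (W : set M) (f : M -> R) : Prop :=
  smooth_on (cmap c @` (W `&` cdom c)) (f \o cinv c).

(* the partial derivative of f in the i-th coordinate of the chart c, at p *)
Definition pd (c : chart M) (i : 'I_d) (f : M -> R) (p : M) : R :=
  partial i (f \o cinv c) (cmap c p).

(* df_p, as a column *)
Definition diff_fun (c : chart M) (f : M -> R) (p : M) : 'cV[R]_d :=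
  \col_i pd c i f p.

Definition jac (c c' : chart M) (p : M) : 'M[R]_d :=
  \matrix_(i, j) pd c i (fun q => cmap c' q 0 j) p.

(* A tensor field is the family of its components in the charts. Tangent
   vectors are rows, covectors are columns, and a (1,1)-tensor F acts on a
   tangent vector u by u *m F. Only the values at points p of [cdom c] are
   meaningful; two families of components are related by the Jacobian. *)
Definition vectors := chart M -> M -> 'rV[R]_d.
Definition covectors := chart M -> M -> 'cV[R]_d.
Definition matrices := chart M -> M -> 'M[R]_d.

Definition vector_field (W : set M) (X : vectors) : Prop :=
  (forall c c' p, W p -> cdom c p -> cdom c' p ->
     X c' p = X c p *m jac c c' p) /\
  (forall c j, smooth c W (fun p => X c p 0 j)).

Definition one_form (W : set M) (eta : covectors) : Prop :=
  (forall c c' p, W p -> cdom c p -> cdom c' p ->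
     eta c p = jac c c' p *m eta c' p) /\
  (forall c j, smooth c W (fun p => eta c p j 0)).

Definition tensor11 (W : set M) (F : matrices) : Prop :=
  (forall c c' p, W p -> cdom c p -> cdom c' p ->
     F c p *m jac c c' p = jac c c' p *m F c' p) /\
  (forall c i j, smooth c W (fun p => F c p i j)).

Definition ev (a : 'cV[R]_d) (u : 'rV[R]_d) : R := (u *m a) 0 0.
Definition bil (G : 'M[R]_d) (u v : 'rV[R]_d) : R := (u *m G *m v^T) 0 0.

Definition riemannian_metric (g : matrices) : Prop :=
  [/\ forall c c' p, cdom c p -> cdom c' p ->
        g c p = jac c c' p *m g c' p *m (jac c c' p)^T,
      forall c i j, smooth c setT (fun p => g c p i j),
      forall c p, cdom c p -> (g c p)^T = g c p &
      forall c p, cdom c p -> forall u, u != 0 -> 0 < bil (g c p) u u].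

(* u(f) at p, for a tangent vector u at p *)
Definition dirder (c : chart M) (u : 'rV[R]_d) (f : M -> R) (p : M) : R :=
  ev (diff_fun c f p) u.

(* [X, Y]^k = X(Y^k) - Y(X^k) *)
Definition lie_bracket (X Y : vectors) : vectors := fun c p =>
  \row_k (dirder c (X c p) (fun q => Y c q 0 k) p
          - dirder c (Y c p) (fun q => X c q 0 k) p).

(* The factor 1/2 is the convention
   2 d eta(X, Y) = X(eta(Y)) - Y(eta(X)) - eta([X, Y]), see [ext_dE]. *)
Definition ext_d (eta : covectors) : matrices := fun c p =>
  \matrix_(i, j) (2^-1 * (pd c i (fun q => eta c q j 0) p
                          - pd c j (fun q => eta c q i 0) p)).

Lemma dirder_ev (W : set M) (eta : covectors) (Y : vectors) c p u :
  one_form W eta -> vector_field W Y -> W p -> cdom c p ->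
  dirder c u (fun q => ev (eta c q) (Y c q)) p =
  \sum_k (dirder c u (fun q => Y c q 0 k) p * eta c p k 0
          + Y c p 0 k * dirder c u (fun q => eta c q k 0) p).
Proof.
move=> [_ eS] [_ YS] Wp cp.
have im : (cmap c @` (W `&` cdom c)) (cmap c p) by exists p.
have dY k : differentiable ((fun q => Y c q 0 k) \o cinv c) (cmap c p).
  exact: (YS c k [::] _ im).
have de k : differentiable ((fun q => eta c q k 0) \o cinv c) (cmap c p).
  exact: (eS c k [::] _ im).
have pdE i : pd c i (fun q => ev (eta c q) (Y c q)) p =
    \sum_k (pd c i (fun q => Y c q 0 k) p * eta c p k 0
          + Y c p 0 k * pd c i (fun q => eta c q k 0) p).
  rewrite /pd /partial.
  have -> : (fun q => ev (eta c q) (Y c q)) \o cinv c =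
    \sum_k (((fun q => Y c q 0 k) \o cinv c) *
            ((fun q => eta c q k 0) \o cinv c)).
    by apply/funext => x; rewrite fct_sumE /= /ev mxE.
  rewrite derive_sum; last first.
    by move=> k; apply: derivableM; apply: diff_derivable.
  apply: eq_bigr => k _; rewrite deriveM; try exact: diff_derivable.
  by rewrite /= cmapK // /GRing.scale /= addrC mulrC; congr (_ + _); rewrite mulrC.
rewrite /dirder /ev mxE.
under eq_bigr do rewrite mxE pdE mulr_sumr.
rewrite exchange_big /=; apply: eq_bigr => k _.
rewrite !mxE mulr_suml mulr_sumr -big_split /=; apply: eq_bigr => i _.
by rewrite !mxE mulrDr mulrA mulrCA.
Qed.

Lemma ext_dE (W : set M) (eta : covectors) (X Y : vectors) c p :
  one_form W eta -> vector_field W X -> vector_field W Y -> W p -> cdom c p ->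
  2 * bil (ext_d eta c p) (X c p) (Y c p) =
  dirder c (X c p) (fun q => ev (eta c q) (Y c q)) p
  - dirder c (Y c p) (fun q => ev (eta c q) (X c q)) p
  - ev (eta c p) (lie_bracket X Y c p).
Proof.
move=> he hX hY Wp cp.
rewrite (dirder_ev _ he hY Wp cp) (dirder_ev _ he hX Wp cp).
rewrite [ev (eta c p) (lie_bracket X Y c p)]/ev [in RHS]mxE -!sumrB.
have -> : bil (ext_d eta c p) (X c p) (Y c p) =
  2^-1 * (\sum_k (Y c p 0 k * dirder c (X c p) (fun q => eta c q k 0) p)
        - \sum_k (X c p 0 k * dirder c (Y c p) (fun q => eta c q k 0) p)).
  rewrite /bil mxE mulrBr.
  under eq_bigr do rewrite !mxE mulr_suml.
  have -> : \sum_k Y c p 0 k * dirder c (X c p) (fun q => eta c q k 0) p =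
    \sum_j \sum_i X c p 0 i * pd c i (fun q => eta c q j 0) p * Y c p 0 j.
    apply: eq_bigr => k _; rewrite /dirder /ev mxE mulr_sumr.
    by apply: eq_bigr => i _; rewrite !mxE mulrC.
  have -> : \sum_k X c p 0 k * dirder c (Y c p) (fun q => eta c q k 0) p =
    \sum_j \sum_i X c p 0 i * pd c j (fun q => eta c q i 0) p * Y c p 0 j.
    rewrite exchange_big; apply: eq_bigr => k _; rewrite /dirder /ev mxE mulr_sumr.
    by apply: eq_bigr => i _; rewrite !mxE -mulrA; congr (_ * _); rewrite mulrC.
  rewrite -mulrBr -sumrB mulr_sumr; apply: eq_bigr => j _.
  rewrite -sumrB mulr_sumr; apply: eq_bigr => i _.
  by rewrite !mxE; ring.
rewrite mulrA divff ?pnatr_eq0// mul1r -sumrB; apply: eq_bigr => k _.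
rewrite !mxE mulrBl; ring.
Qed.

Record affine_connection (nabla : vectors -> matrices) : Prop := {
  (* nabla Y is the (1,1)-tensor field u |-> nabla_u Y *)
  connection_tensor : forall W Y, open W -> vector_field W Y ->
    tensor11 W (nabla Y) ;
  connection_local : forall W Y Z, open W ->
    vector_field W Y -> vector_field W Z ->
    (forall c p, W p -> cdom c p -> Y c p = Z c p) ->
    forall c p, W p -> cdom c p -> nabla Y c p = nabla Z c p ;
  connectionD : forall W Y Z, open W ->
    vector_field W Y -> vector_field W Z ->
    forall c p, W p -> cdom c p ->
    nabla (fun c' q => Y c' q + Z c' q) c p = nabla Y c p + nabla Z c p ;
  connection_leibniz : forall W (f : M -> R) Y, open W ->
    (forall c, smooth c W f) -> vector_field W Y ->
    forall c p, W p -> cdom c p ->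
    nabla (fun c' q => f q *: Y c' q) c p =
    diff_fun c f p *m Y c p + f p *: nabla Y c p
}.

Definition torsion_free (nabla : vectors -> matrices) : Prop :=
  forall W X Y, open W -> vector_field W X -> vector_field W Y ->
  forall c p, W p -> cdom c p ->
  X c p *m nabla Y c p - Y c p *m nabla X c p = lie_bracket X Y c p.

Definition metric_connection (g : matrices) (nabla : vectors -> matrices) :
    Prop :=
  forall W X Y Z, open W ->
  vector_field W X -> vector_field W Y -> vector_field W Z ->
  forall c p, W p -> cdom c p ->
  dirder c (X c p) (fun q => bil (g c q) (Y c q) (Z c q)) p =
  bil (g c p) (X c p *m nabla Y c p) (Z c p)
  + bil (g c p) (Y c p) (X c p *m nabla Z c p).

(* A connection is given by its action on vector fields over every open set,
   compatibly with restrictions. *)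
Definition levi_civita (g : matrices) (nabla : vectors -> matrices) : Prop :=
  [/\ affine_connection nabla, torsion_free nabla & metric_connection g nabla].

Definition almost_contact_metric (phi : matrices) (xi : vectors)
    (eta : covectors) (g : matrices) : Prop :=
  [/\ tensor11 setT phi, vector_field setT xi, one_form setT eta &
      riemannian_metric g] /\
  forall c p, cdom c p ->
  [/\ forall u, u *m phi c p *m phi c p = - u + ev (eta c p) u *: xi c p,
      ev (eta c p) (xi c p) = 1 &
      forall u v, bil (g c p) (u *m phi c p) (v *m phi c p) =
        bil (g c p) u v - ev (eta c p) u * ev (eta c p) v].

End Tensors.

Section Forms.
Context {R : realType} {d : nat}.

(* Forms of degree k on the tangent space. Alternation and multilinearity are
   not part of the type; they hold for the forms constructed below. *)
Definition form (k : nat) := ('I_k -> 'rV[R]_d) -> R.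

(* The normalization (k + l)!^-1 goes with the factor 1/2 in [ext_d]. *)
Definition wedge (k l : nat) (a : form k) (b : form l) : form (k + l)%N :=
  fun v => ((k + l)`!%N%:R)^-1 * \sum_(s : 'S_(k + l)%N) (-1) ^+ s *
    (a (fun i => v (s (lshift l i))) * b (fun i => v (s (rshift k i)))).

Fixpoint wedge_exp (b : form 2) (m : nat) : form (m * 2)%N :=
  if m is m'.+1 then wedge b (@wedge_exp b m') else fun=> 1.

Definition form_of_covector (a : 'cV[R]_d) : form 1 := fun v => ev a (v ord0).
Definition form_of_matrix (G : 'M[R]_d) : form 2 :=
  fun v => bil G (v ord0) (v ord_max).

End Forms.

Section Contact.
Context {R : realType} {d : nat} {M : manifold R d}.

Definition contact_form (eta : @covectors R d M) : Prop :=
  one_form setT eta /\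
  exists m : nat, d = (2 * m + 1)%N /\
  forall c p, cdom c p -> exists v : 'I_(1 + m * 2)%N -> 'rV[R]_d,
    wedge (form_of_covector (eta c p))
      (wedge_exp (form_of_matrix (ext_d eta c p)) (m := m)) v <> 0.

(* the fibre of ker eta at p, in the chart c *)
Definition contact_dist (eta : @covectors R d M) (c : chart M) (p : M) :
    set 'rV[R]_d :=
  [set u | ev (eta c p) u = 0].

(* Fibrewise maps of a distribution D, in charts; only the values on D are
   meaningful. *)
Definition fibre_map := chart M -> M -> 'rV[R]_d -> 'rV[R]_d.

(* Smoothness: smooth local sections of D are mapped to smooth sections. *)
Record bundle_endomorphism (D : chart M -> M -> set 'rV[R]_d)
    (F : fibre_map) : Prop := {
  bundle_endo_sub : forall c p u, cdom c p -> D c p u -> D c p (F c p u) ;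
  bundle_endo_linear : forall c p (a : R) u v, cdom c p ->
    D c p u -> D c p v -> F c p (a *: u + v) = a *: F c p u + F c p v ;
  bundle_endo_chart : forall c c' p u, cdom c p -> cdom c' p -> D c p u ->
    F c' p (u *m jac c c' p) = F c p u *m jac c c' p ;
  bundle_endo_smooth : forall (W : set M) X, open W -> vector_field W X ->
    (forall c p, W p -> cdom c p -> D c p (X c p)) ->
    vector_field W (fun c p => F c p (X c p))
}.

Definition bundle_automorphism (D : chart M -> M -> set 'rV[R]_d)
    (F : fibre_map) : Prop :=
  bundle_endomorphism D F /\
  exists G : fibre_map, bundle_endomorphism D G /\
    forall c p u, cdom c p -> D c p u ->
      G c p (F c p u) = u /\ F c p (G c p u) = u.

(* The adjoint, for g restricted to D, of a map of D into itself. *)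
Definition adjoint_on (D : chart M -> M -> set 'rV[R]_d) (g : @matrices R d M)
    (F : fibre_map) : fibre_map := fun c p u =>
  xget 0 [set w | D c p w /\
    forall v, D c p v -> bil (g c p) w v = bil (g c p) u (F c p v)].

Definition skew_part (D : chart M -> M -> set 'rV[R]_d) (g : @matrices R d M)
    (F : fibre_map) : fibre_map := fun c p u =>
  2^-1 *: (F c p u - adjoint_on D g F c p u).

(* B = (A|_D - A^* ) / 2 on D = ker eta, for A = nabla xi *)
Definition contact_B (eta : @covectors R d M) (g : @matrices R d M)
    (nabla : @vectors R d M -> @matrices R d M) (xi : @vectors R d M) :
    fibre_map :=
  skew_part (contact_dist eta) g (fun c p u => u *m nabla xi c p).

End Contact.

(* Main.v *)
(* At a point write Q for the projection onto D along xi, G for the metric and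
   A^* = G A^T G^-1. On D, B is the restriction of (A - A^* ) Q / 2; computing
   with local vector fields that are constant in a chart shows that B represents
   d eta, i.e. g(BX, Y) = d eta(X, Y). Since phi is g-orthogonal on D,
   anti-invariance of d eta means that B anticommutes with phi.

   If u <> 0 in D is in the kernel of d eta restricted to D, then by alternation
   eta /\ (d eta)^m need only be evaluated on arguments that contain u and at
   most one vector outside D, where every term vanishes. Hence d eta is
   nondegenerate on D and B is invertible there. Smoothness of B and of its
   inverse comes from Cramer's rule.

   For the dimension, complexify. Anti-invariance gives
   d eta(phi X, Y) = d eta(X, phi Y), so that the eigenspaces of phi for i and
   -i are d eta-orthogonal, and d eta is nondegenerate and alternating on each
   of them. Their dimension is thus even; they are complex conjugate and together
   span the complexification of D, whence 4 | dim D. *)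

Require Import Defs.
From mathcomp Require Import all_boot all_order all_fingroup all_algebra.
From mathcomp Require Import all_classical all_reals all_analysis.
From mathcomp Require Import ring complex.

(* MathComp's sesquilinear forms shadow [form] and [form_of_matrix] of Defs. *)
Import Defs.

Import Order.TTheory GRing.Theory Num.Theory.
Import numFieldNormedType.Exports.

Set Implicit Arguments.
Unset Strict Implicit.
Unset Printing Implicit Defensive.

Local Open Scope classical_set_scope.
Local Open Scope ring_scope.

(** * Smooth functions on open subsets of R^d *)

Lemma near_eq_differentiable (R : numFieldType) (V W : normedModType R)
    (f g : V -> W) (x : V) :
  (\near x, f x = g x) -> differentiable f x -> differentiable g x.
Proof.
move=> fg df; have [cdf fE] := (diff_locallyP _ _).1 df.
have gE : g \o shift x = cst (g x) + 'd f x +o_ 0 id.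
  apply/eqaddoP => e e0.
  have fgx := nbhs_singleton fg.
  have := (eqaddoP (nbhs_filter_on 0) _ _ _).1 fE e e0.
  have fg0 : \forall h \near 0, f (h + x) = g (h + x).
    by move: fg; rewrite (near_shift 0) subr0.
  move=> H; near=> h.
  have ef : f (h + x) = g (h + x) by near: h.
  have : `|((f \o shift x) - (cst (f x) + 'd f x)) h| <= e * `|h| by near: h.
  by rewrite !fctE /= -fgx -ef.
have dE : 'd g x = 'd f x :> (V -> W) by exact: diff_unique.
by apply/diff_locallyP; rewrite dE.
Unshelve. all: by end_near. Qed.

Section SmoothFunctions.
Context {R : realType}.

Lemma near_eq_partial d (i : 'I_d) (f g : 'rV[R]_d -> R) x :
  (\near x, f x = g x) -> partial i f x = partial i g x.
Proof. exact: near_eq_derive. Qed.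

Lemma smooth_on_sub d (U V : set 'rV[R]_d) f :
  U `<=` V -> smooth_on V f -> smooth_on U f.
Proof. by move=> UV fV s x Ux; apply: fV; apply: UV. Qed.

Lemma smooth_on_partial d (U : set 'rV[R]_d) i f :
  smooth_on U f -> smooth_on U (partial i f).
Proof. by move=> fU s x Ux; rewrite -foldr_rcons; apply: fU. Qed.

(* Differentiability of all iterated partial derivatives follows from a class
   of differentiable functions stable, up to equality on U, under partials. *)
Lemma smooth_on_coind d (U : set 'rV[R]_d) (P : ('rV[R]_d -> R) -> Prop) :
  open U ->
  (forall f, P f -> forall x, U x -> differentiable f x) ->
  (forall f i, P f -> exists2 g, P g & forall x, U x -> partial i f x = g x) ->
  forall f, P f -> smooth_on U f.
Proof.
move=> oU Pdiff Ppart f Pf s.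
have nearU x (g h : 'rV[R]_d -> R) : U x -> (forall y, U y -> g y = h y) ->
    \near x, g x = h x.
  by move=> Ux gh; near=> y; apply: gh; near: y; exact: open_nbhs_nbhs.
(* Every iterated partial derivative agrees on [U] with a member of [P]; as [U] is open, equality on
   [U] survives one more derivative. *)
have [g Pg gE] : exists2 g, P g &
    forall x, U x -> g x = foldr partial f s x.
  elim: s => [|i s [g Pg gE]]; first by exists f.
  have [h Ph hE] := Ppart _ i Pg; exists h => // x Ux.
  by rewrite -hE //=; apply: near_eq_partial; exact: nearU.
move=> x Ux; apply: near_eq_differentiable (Pdiff _ Pg _ Ux).
exact: nearU.
Unshelve. all: by end_near. Qed.

Lemma derive_row_mx d (f : 'rV[R]_d -> R) x (v : 'rV[R]_d) :
  differentiable f x -> 'D_v f x = \sum_i v 0 i * partial i f x.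
Proof.
move=> df; rewrite deriveE // [v in LHS]row_sum_delta linear_sum.
by apply: eq_bigr => i _; rewrite linearZ /= /partial deriveE.
Qed.

Lemma differentiable_row_mx d e (h : 'rV[R]_d -> 'rV[R]_e) x :
  (forall j, differentiable (fun y => h y 0 j) x) -> differentiable h x.
Proof.
move=> dh; have -> : h = \sum_j (fun y => h y 0 j *: delta_mx 0 j).
  by apply/funext => y; rewrite fct_sumE -row_sum_delta.
by apply: differentiable_sum => j; apply: differentiableZl.
Qed.

Lemma partial_comp d e (f : 'rV[R]_e -> R) (h : 'rV[R]_d -> 'rV[R]_e) i x :
  differentiable f (h x) -> (forall j, differentiable (fun y => h y 0 j) x) ->
  partial i (f \o h) x =
  \sum_j partial i (fun y => h y 0 j) x * partial j f (h x).
Proof.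
move=> df dhj; have dh := differentiable_row_mx dhj.
rewrite /partial deriveE; last exact: differentiable_comp.
rewrite diff_comp //= -deriveE // derive_row_mx //.
apply: eq_bigr => j _; congr (_ * _).
by rewrite -deriveE // derive_mx ?mxE //; exact: diff_derivable.
Qed.

(** A class to which [smooth_on_coind] applies, so that sums, products, inverses and composites are
    treated together without formulas for higher derivatives. The composition rule takes smooth [f]
    and [h], so that the chain rule can reuse it with the same [h] and a partial derivative of
    [f]. *)
Inductive smooth_closure d (U : set 'rV[R]_d) : ('rV[R]_d -> R) -> Prop :=
| smooth_closure_base f of smooth_on U f : smooth_closure U f
| smooth_closureD f g of smooth_closure U f & smooth_closure U g :
    smooth_closure U (f + g)
| smooth_closureM f g of smooth_closure U f & smooth_closure U g :
    smooth_closure U (f * g)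
| smooth_closureV f of smooth_closure U f & (forall x, U x -> f x != 0) :
    smooth_closure U (fun x => (f x)^-1)
| smooth_closure_comp e (V : set 'rV[R]_e) (h : 'rV[R]_d -> 'rV[R]_e) f of
    smooth_on V f & (forall j, smooth_on U (fun x => h x 0 j)) &
    (forall x, U x -> V (h x)) : smooth_closure U (f \o h).

Lemma smooth_on_cst d (U : set 'rV[R]_d) (k : R) : smooth_on U (cst k).
Proof.
move=> s x _; have [k' ->] : exists k', foldr partial (cst k) s = cst k'.
  elim: s => [|i s [k' /= ->]]; first by exists k.
  by exists 0; apply/funext => y; rewrite /partial derive_cst.
exact: differentiable_cst.
Qed.

Lemma smooth_closure_differentiable d (U : set 'rV[R]_d) f x :
  smooth_closure U f -> U x -> differentiable f x.
Proof.
move=> fU Ux; elim: f / fU => [f fU|f g _ fx _ gx|f g _ fx _ gx|f _ fx f0|].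
- exact: (fU [::]).
- exact: differentiableD.
- exact: differentiableM.
- by apply: differentiableV => //; exact: f0.
- move=> e V h f fV hU UV; apply: differentiable_comp.
    by apply: differentiable_row_mx => j; exact: (hU j [::]).
  exact: (fV [::] _ (UV _ Ux)).
Qed.

Lemma smooth_closure_sum d (U : set 'rV[R]_d) n (F : 'I_n -> 'rV[R]_d -> R) :
  (forall i, smooth_closure U (F i)) -> smooth_closure U (\sum_i F i).
Proof.
move=> FU; elim/big_ind: _ => [|f g|i _]; last exact: FU.
  by rewrite -[0]/(cst 0); exact/smooth_closure_base/smooth_on_cst.
exact: smooth_closureD.
Qed.

(** The sum, Leibniz, quotient and chain rules express the derivative by the constructors again.
    They hold only on [U], where the functions involved are differentiable. *)
Lemma smooth_closure_partial d (U : set 'rV[R]_d) f i :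
  smooth_closure U f ->
  exists2 g, smooth_closure U g & forall x, U x -> partial i f x = g x.
Proof.
elim: f / => [f fU|f g fU [f' f'U fE] gU [g' g'U gE]|
  f g fU [f' f'U fE] gU [g' g'U gE]|f fU [f' f'U fE] f0|].
- by exists (partial i f) => //; apply/smooth_closure_base/smooth_on_partial.
- exists (f' + g'); first exact: smooth_closureD.
  move=> x Ux; rewrite /partial deriveD ?fctE -?fE -?gE //;
    by apply: diff_derivable; apply: smooth_closure_differentiable Ux.
- exists (f * g' + g * f').
    by apply: smooth_closureD; apply: smooth_closureM.
  move=> x Ux; rewrite /partial deriveM ?fctE -?fE -?gE //;
    by apply: diff_derivable; apply: smooth_closure_differentiable Ux.
- exists ((cst (-1) * ((fun x => (f x)^-1) * (fun x => (f x)^-1))) * f').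
    do !apply: smooth_closureM => //; try exact: smooth_closureV.
    exact/smooth_closure_base/smooth_on_cst.
  move=> x Ux; have df := smooth_closure_differentiable fU Ux.
  have dV : differentiable (fun y => (f y)^-1) x.
    by apply: differentiableV => //; exact: f0.
  rewrite /partial deriveE // diffV //; last exact: f0.
  by rewrite /= -deriveE // !fctE -fE // mulN1r -invfM -expr2.
- move=> e V h f fV hU UV.
  exists (\sum_j partial i (fun y => h y 0 j) * (partial j f \o h)).
    apply: smooth_closure_sum => j; apply: smooth_closureM.
      exact/smooth_closure_base/smooth_on_partial.
    by apply: smooth_closure_comp hU UV; exact: smooth_on_partial.
  move=> x Ux; rewrite partial_comp; first by rewrite fct_sumE.
    exact: (fV [::] _ (UV _ Ux)).
  by move=> j; exact: (hU j [::]).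
Qed.

Lemma smooth_closureP d (U : set 'rV[R]_d) f :
  open U -> smooth_closure U f -> smooth_on U f.
Proof.
move=> oU; apply: smooth_on_coind => // [g gU x|g i].
  exact: smooth_closure_differentiable.
exact: smooth_closure_partial.
Qed.

(** Coinduction on the class of functions that agree on [U] with some smooth one. *)
Lemma smooth_on_ext d (U : set 'rV[R]_d) f g :
  open U -> (forall x, U x -> f x = g x) -> smooth_on U f -> smooth_on U g.
Proof.
move=> oU fg fU.
apply: (smooth_on_coind (P := fun h =>
  exists2 f, smooth_on U f & forall x, U x -> f x = h x)) => //;
  last by exists f.
  move=> h [k kU kh] x Ux; apply: near_eq_differentiable (kU [::] x Ux).
  by near=> y; apply: kh; near: y; exact: open_nbhs_nbhs.
move=> h i [k kU kh]; exists (partial i k).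
  by exists (partial i k) => //; exact: smooth_on_partial.
move=> x Ux; apply: near_eq_partial.
by near=> y; rewrite kh //; near: y; exact: open_nbhs_nbhs.
Unshelve. all: by end_near. Qed.

End SmoothFunctions.

(** * Functions, changes of chart and Jacobians on a manifold *)

Section ManifoldCalculus.
Context {R : realType} {d : nat} {M : manifold R d}.
Implicit Types (c : chart M) (W : set M) (f g : M -> R) (p : M).

(** Points near [cmap c p] lie in the open image of the chart, and continuity of [cinv c] puts their
    preimages in [W]. *)
Lemma chart_image_open c W : open W -> open (cmap c @` (W `&` cdom c)).
Proof.
move=> oW; rewrite openE => _ [p [Wp cp] <-].
have nc : nbhs (cmap c p) (cmap c @` cdom c).
  by apply: open_nbhs_nbhs; split; [exact: cmap_open|exists p].
have nW : nbhs (cmap c p) (cinv c @^-1` W).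
  by apply: (cinv_continuous cp); rewrite cmapK //; exact: open_nbhs_nbhs.
rewrite /interior; near=> y.
have [q cq qy] : (cmap c @` cdom c) y by near: y.
exists q => //; split=> //; rewrite -(cmapK cq) qy.
by near: y.
Unshelve. all: by end_near. Qed.

Lemma near_chart c W p (P : set M) : open W -> W p -> cdom c p ->
  (forall q, W q -> cdom c q -> P q) -> \forall x \near cmap c p, P (cinv c x).
Proof.
move=> oW Wp cp WP; have nW : nbhs (cmap c p) (cmap c @` (W `&` cdom c)).
  by apply: open_nbhs_nbhs; split; [exact: chart_image_open|exists p].
near=> y.
have [q [Wq cq] <-] : (cmap c @` (W `&` cdom c)) y by near: y.
by rewrite cmapK //; exact: WP.
Unshelve. all: by end_near. Qed.

Lemma eq_pd c W i f g p : open W -> W p -> cdom c p ->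
  (forall q, W q -> cdom c q -> f q = g q) -> pd c i f p = pd c i g p.
Proof. by move=> oW Wp cp fg; apply: near_eq_partial; exact: near_chart fg. Qed.

Lemma smooth_differentiable c W f p : W p -> cdom c p -> smooth c W f ->
  differentiable (f \o cinv c) (cmap c p).
Proof. by move=> Wp cp fW; apply: (fW [::]); exists p. Qed.

Lemma smoothI c W f : smooth c (W `&` cdom c) f = smooth c W f.
Proof. by rewrite /smooth -setIA setIid. Qed.

Lemma smooth_sub c W W' f : W `<=` W' -> smooth c W' f -> smooth c W f.
Proof.
move=> WW'; apply: smooth_on_sub; apply: image_subset; exact: setSI.
Qed.

Lemma eq_smooth c W f g : open W ->
  (forall p, W p -> cdom c p -> f p = g p) -> smooth c W f -> smooth c W g.
Proof.
move=> oW fg; apply: smooth_on_ext; first exact: chart_image_open.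
by move=> _ [p [Wp cp] <-] /=; rewrite cmapK // fg.
Qed.

Lemma smooth_cst c W (k : R) : smooth c W (fun=> k).
Proof. exact: smooth_on_cst. Qed.

Lemma smoothD c W f g : open W ->
  smooth c W f -> smooth c W g -> smooth c W (fun p => f p + g p).
Proof.
move=> oW fW gW; apply: smooth_closureP; first exact: chart_image_open.
by apply: smooth_closureD; apply: smooth_closure_base.
Qed.

Lemma smoothM c W f g : open W ->
  smooth c W f -> smooth c W g -> smooth c W (fun p => f p * g p).
Proof.
move=> oW fW gW; apply: smooth_closureP; first exact: chart_image_open.
by apply: smooth_closureM; apply: smooth_closure_base.
Qed.

Lemma smoothV c W f : open W -> (forall p, W p -> cdom c p -> f p != 0) ->
  smooth c W f -> smooth c W (fun p => (f p)^-1).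
Proof.
move=> oW f0 fW; apply: smooth_closureP; first exact: chart_image_open.
apply: smooth_closureV; first exact: smooth_closure_base.
by move=> _ [p [Wp cp] <-] /=; rewrite cmapK //; exact: f0.
Qed.

Lemma smooth_sum c W (I : Type) (r : seq I) (P : pred I) (F : I -> M -> R) :
  open W -> (forall i, smooth c W (F i)) ->
  smooth c W (fun p => \sum_(i <- r | P i) F i p).
Proof.
move=> oW FW; elim: r => [|i r IH].
  by under [X in smooth c W X]eq_fun do rewrite big_nil; exact: smooth_cst.
under [X in smooth c W X]eq_fun do rewrite big_cons.
by case: (P i) => //; exact: smoothD.
Qed.

Lemma smooth_prod c W (I : Type) (r : seq I) (P : pred I) (F : I -> M -> R) :
  open W -> (forall i, smooth c W (F i)) ->
  smooth c W (fun p => \prod_(i <- r | P i) F i p).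
Proof.
move=> oW FW; elim: r => [|i r IH].
  by under [X in smooth c W X]eq_fun do rewrite big_nil; exact: smooth_cst.
under [X in smooth c W X]eq_fun do rewrite big_cons.
by case: (P i) => //; exact: smoothM.
Qed.

Lemma smooth_pd c W f i : open W -> smooth c W f -> smooth c W (pd c i f).
Proof.
move=> oW fW; apply: smooth_on_ext (smooth_on_partial i fW).
  exact: chart_image_open.
by move=> _ [p [Wp cp] <-]; rewrite /pd /= cmapK.
Qed.

Lemma smooth_coord c c' j : smooth c (cdom c') (fun p => cmap c' p 0 j).
Proof. by rewrite /smooth setIC; exact: chart_compatible. Qed.

Lemma smooth_change c c' W f : open W -> W `&` cdom c' `<=` cdom c ->
  smooth c W f -> smooth c' W f.
Proof.
move=> oW Wc fW; have oI := chart_image_open (c := c') oW.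
have fE : smooth_on (cmap c' @` (W `&` cdom c'))
    ((f \o cinv c) \o (cmap c \o cinv c')).
  apply: smooth_closureP => //; apply: smooth_closure_comp fW _ _ => [j|].
    have := @smooth_coord c' c j; apply: smooth_on_sub.
    by apply: image_subset => p Wp; split; [exact: Wc|case: Wp].
  move=> _ [p [Wp c'p] <-]; rewrite /= cmapK //; exists p => //; split=> //.
  exact: Wc.
apply: smooth_on_ext fE => // _ [p [Wp c'p] <-]; rewrite /= !cmapK //.
exact: Wc.
Qed.

Lemma jacE c c' p i j : jac c c' p i j = pd c i (fun q => cmap c' q 0 j) p.
Proof. by rewrite mxE. Qed.

Lemma pd_chain c c' W f p i : open W -> W p -> cdom c p -> cdom c' p ->
  smooth c' W f -> pd c i f p = \sum_j jac c c' p i j * pd c' j f p.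
Proof.
move=> oW Wp cp c'p fW.
have -> : pd c i f p =
    partial i ((f \o cinv c') \o (cmap c' \o cinv c)) (cmap c p).
  (* The factorization through [c'] is valid only where [c'] is defined, which is a neighbourhood of
     [p]. *)
  apply: near_eq_partial.
  apply: (near_chart (W := cdom c')
    (P := fun q => f q = f (cinv c' (cmap c' q)))) => //.
    exact: cdom_open.
  by move=> q c'q _; rewrite cmapK.
rewrite partial_comp /= ?cmapK //.
- by apply: eq_bigr => j _; rewrite jacE.
- exact: smooth_differentiable fW.
- move=> j; apply: (smooth_differentiable (f := fun q => cmap c' q 0 j))
    (@smooth_coord c c' j) => //.
Qed.

Lemma jac_comp c c' c'' p : cdom c p -> cdom c' p -> cdom c'' p ->
  jac c c'' p = jac c c' p *m jac c' c'' p.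
Proof.
move=> cp c'p c''p; apply/matrixP => i j; rewrite jacE mxE.
rewrite (pd_chain i (cdom_open c'') c''p cp c'p); last exact: smooth_coord.
by apply: eq_bigr => k _; rewrite [jac c' c'' p _ _]jacE.
Qed.

Lemma jac_id c p : cdom c p -> jac c c p = 1%:M.
Proof.
move=> cp; apply/matrixP => i j; rewrite jacE mxE.
rewrite [LHS](_ : _ = partial i (fun x : 'rV[R]_d => x 0 j) (cmap c p)).
  have /(derive_mx (M := id)) : derivable id (cmap c p) 'e_i by [].
  by rewrite derive_id => /matrixP /(_ 0 j); rewrite !mxE eqxx eq_sym => ->.
apply: near_eq_partial.
have nc : nbhs (cmap c p) (cmap c @` cdom c).
  by apply: open_nbhs_nbhs; split; [exact: cmap_open|exists p].
near=> x; have [q cq <-] : (cmap c @` cdom c) x by near: x.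
by rewrite /= cmapK.
Unshelve. all: by end_near. Qed.

Lemma jacK c c' p : cdom c p -> cdom c' p -> jac c c' p *m jac c' c p = 1%:M.
Proof. by move=> cp c'p; rewrite -jac_comp // jac_id. Qed.

Lemma smooth_jac c c' c'' i j :
  smooth c'' (cdom c `&` cdom c') (fun p => jac c c' p i j).
Proof.
have oI : open (cdom c `&` cdom c') by apply: openI; exact: cdom_open.
apply: (smooth_change (c := c)) => //; first by move=> q [[]].
apply: (@eq_smooth _ _ (pd c i (fun q => cmap c' q 0 j))) => //.
  by move=> p _ _; rewrite jacE.
apply: smooth_pd => //; apply: smooth_sub (@smooth_coord c c' j).
exact: subIsetr.
Qed.

(** Extends a tangent vector at a point to a local vector field, so that identities between fields
    can be read as identities between vectors. *)
Definition const_field c (u : 'rV[R]_d) : @vectors R d M :=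
  fun c' p => u *m jac c c' p.

Lemma const_fieldE c u p : cdom c p -> const_field c u c p = u.
Proof. by move=> cp; rewrite /const_field jac_id // mulmx1. Qed.

Lemma const_field_vector_field c u : vector_field (cdom c) (const_field c u).
Proof.
split=> [c' c'' p cp c'p c''p|c' j].
  by rewrite /const_field (jac_comp cp c'p c''p) mulmxA.
rewrite -smoothI.
have oI : open (cdom c `&` cdom c') by apply: openI; exact: cdom_open.
under [X in smooth _ _ X]eq_fun do rewrite mxE.
apply: smooth_sum => // k; apply: smoothM => //; first exact: smooth_cst.
exact: smooth_jac.
Qed.

End ManifoldCalculus.

(** * Smooth matrix-valued functions *)

Lemma mulmx1_invmx (R : comUnitRingType) n (A B : 'M[R]_n) :
  A *m B = 1%:M -> invmx A = B.
Proof.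
move=> AB; have [uA _] := mulmx1_unit AB.
by rewrite -[RHS]mul1mx -(mulVmx uA) -mulmxA AB mulmx1.
Qed.

Section SmoothMatrices.
Context {R : realType} {d : nat} {M : manifold R d}.
Variables (c : chart M) (W : set M) (oW : open W).

Definition smooth_mx m n (F : M -> 'M[R]_(m, n)) :=
  forall i j, smooth c W (fun p => F p i j).

Lemma smooth_mxM m n k (F : M -> 'M[R]_(m, n)) (G : M -> 'M[R]_(n, k)) :
  smooth_mx F -> smooth_mx G -> smooth_mx (fun p => F p *m G p).
Proof.
move=> FW GW i j; under [X in smooth _ _ X]eq_fun do rewrite mxE.
by apply: smooth_sum => // l; exact: smoothM.
Qed.

Lemma smooth_mx_cst m n (A : 'M[R]_(m, n)) : smooth_mx (fun=> A).
Proof. by move=> i j; exact: smooth_cst. Qed.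

Lemma smooth_mxD m n (F G : M -> 'M[R]_(m, n)) :
  smooth_mx F -> smooth_mx G -> smooth_mx (fun p => F p + G p).
Proof.
move=> FW GW i j; under [X in smooth _ _ X]eq_fun do rewrite mxE.
exact: smoothD.
Qed.

Lemma smooth_mxZ m n (k : R) (F : M -> 'M[R]_(m, n)) :
  smooth_mx F -> smooth_mx (fun p => k *: F p).
Proof.
move=> FW i j; under [X in smooth _ _ X]eq_fun do rewrite mxE.
by apply: smoothM => //; exact: smooth_cst.
Qed.

Lemma smooth_mxB m n (F G : M -> 'M[R]_(m, n)) :
  smooth_mx F -> smooth_mx G -> smooth_mx (fun p => F p - G p).
Proof.
move=> FW GW; under [X in smooth_mx X]eq_fun do rewrite -scaleN1r.
by apply: smooth_mxD => //; exact: smooth_mxZ.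
Qed.

Lemma smooth_trmx m n (F : M -> 'M[R]_(m, n)) :
  smooth_mx F -> smooth_mx (fun p => (F p)^T).
Proof.
by move=> FW i j; apply: (eq_smooth oW _ (FW j i)) => p _ _; rewrite mxE.
Qed.

Lemma smooth_det n (F : M -> 'M[R]_n) :
  smooth_mx F -> smooth c W (fun p => \det (F p)).
Proof.
move=> FW; rewrite /determinant; apply: smooth_sum => // s.
apply: smoothM => //; first exact: smooth_cst.
by apply: smooth_prod => // i; exact: FW.
Qed.

(** By Cramer's rule the entries of the inverse are cofactors divided by the determinant. *)
Lemma smooth_invmx n (F : M -> 'M[R]_n) :
  (forall p, W p -> cdom c p -> F p \in unitmx) ->
  smooth_mx F -> smooth_mx (fun p => invmx (F p)).
Proof.
move=> Fu FW i j.
apply: (@eq_smooth _ _ _ _ _ (fun p => (\det (F p))^-1 * \adj (F p) i j)) => //.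
  by move=> p Wp cp; rewrite /invmx Fu // [RHS]mxE.
apply: smoothM => //.
  apply: smoothV => // [p Wp cp|]; last exact: smooth_det.
  by rewrite -unitfE -unitmxE; exact: Fu.
under [X in smooth _ _ X]eq_fun do rewrite mxE /cofactor.
apply: smoothM => //; first exact: smooth_cst.
apply: smooth_det => k l.
by apply: (eq_smooth oW _ (FW (lift j k) (lift i l))) => p _ _; rewrite !mxE.
Qed.

End SmoothMatrices.

(** * Algebra of tensor fields and the metric adjoint *)

Section TensorCalculus.
Context {R : realType} {d : nat} {M : manifold R d}.
Implicit Types (W : set M) (F G : @matrices R d M) (X Y : @vectors R d M).

Lemma vector_fieldP W X : vector_field W X <->
  (forall c c' p, W p -> cdom c p -> cdom c' p ->
     X c' p = X c p *m jac c c' p) /\ (forall c, smooth_mx c W (X c)).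
Proof.
split=> -[XJ XS]; split=> //; first by move=> c i j; rewrite ord1.
by move=> c j; exact: XS.
Qed.

Lemma vector_field_sub W W' X :
  W `<=` W' -> vector_field W' X -> vector_field W X.
Proof.
move=> WW' [XJ XS]; split=> [c c' p Wp|c j]; first exact/XJ/WW'.
exact: smooth_sub (XS c j).
Qed.

Lemma eq_vector_field W X Y : open W ->
  (forall c p, W p -> cdom c p -> X c p = Y c p) ->
  vector_field W X -> vector_field W Y.
Proof.
move=> oW XY [XJ XS]; split=> [c c' p Wp cp c'p|c j].
  by rewrite -!XY //; exact: XJ.
by apply: eq_smooth (XS c j) => // p Wp cp; rewrite XY.
Qed.

Lemma tensor11_sub W W' F : W `<=` W' -> tensor11 W' F -> tensor11 W F.
Proof.
move=> WW' [FJ FS]; split=> [c c' p Wp|c i j]; first exact/FJ/WW'.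
exact: smooth_sub (FS c i j).
Qed.

Lemma vector_field_mul W X F : open W ->
  vector_field W X -> tensor11 W F ->
  vector_field W (fun c p => X c p *m F c p).
Proof.
move=> oW /vector_fieldP[XJ XS] [FJ FS]; apply/vector_fieldP; split.
  by move=> c c' p Wp cp c'p; rewrite (XJ c c') // -!mulmxA FJ.
by move=> c; exact: smooth_mxM.
Qed.

Lemma tensor11_id W : tensor11 W (fun _ _ => 1%:M).
Proof.
split=> [c c' p _ _ _|c]; first by rewrite mul1mx mulmx1.
exact: smooth_mx_cst.
Qed.

Lemma tensor11M W F G : open W ->
  tensor11 W F -> tensor11 W G -> tensor11 W (fun c p => F c p *m G c p).
Proof.
move=> oW [FJ FS] [GJ GS]; split; last by move=> c; exact: smooth_mxM.
by move=> c c' p Wp cp c'p; rewrite -mulmxA GJ // mulmxA FJ // mulmxA.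
Qed.

Lemma tensor11D W F G : open W ->
  tensor11 W F -> tensor11 W G -> tensor11 W (fun c p => F c p + G c p).
Proof.
move=> oW [FJ FS] [GJ GS]; split; last by move=> c; exact: smooth_mxD.
by move=> c c' p Wp cp c'p; rewrite mulmxDl mulmxDr FJ // GJ.
Qed.

Lemma tensor11B W F G : open W ->
  tensor11 W F -> tensor11 W G -> tensor11 W (fun c p => F c p - G c p).
Proof.
move=> oW [FJ FS] [GJ GS]; split; last by move=> c; exact: smooth_mxB.
by move=> c c' p Wp cp c'p; rewrite mulmxBl mulmxBr FJ // GJ.
Qed.

Lemma tensor11Z W (k : R) F : open W ->
  tensor11 W F -> tensor11 W (fun c p => k *: F c p).
Proof.
move=> oW [FJ FS]; split; last by move=> c; exact: smooth_mxZ.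
by move=> c c' p Wp cp c'p; rewrite -scalemxAl -scalemxAr FJ.
Qed.

Lemma tensor11_outer W (eta : @covectors R d M) X : open W ->
  one_form W eta -> vector_field W X ->
  tensor11 W (fun c p => eta c p *m X c p).
Proof.
move=> oW [eJ eS] /vector_fieldP[XJ XS]; split.
  by move=> c c' p Wp cp c'p; rewrite -mulmxA -XJ // mulmxA -eJ.
move=> c; apply: smooth_mxM => // i j; rewrite ord1; exact: eS.
Qed.

Lemma tensor11V W F : open W ->
  (forall c p, W p -> cdom c p -> F c p \in unitmx) ->
  tensor11 W F -> tensor11 W (fun c p => invmx (F c p)).
Proof.
move=> oW Fu [FJ FS]; split; last first.
  by move=> c; apply: smooth_invmx => // p; exact: Fu.
move=> c c' p Wp cp c'p; apply: (can_inj (mulKmx (Fu c p Wp cp))).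
by rewrite mulKVmx ?Fu // mulmxA FJ // -mulmxA mulmxV ?Fu // mulmx1.
Qed.

Lemma metric_unitmx (g : @matrices R d M) c p :
  riemannian_metric g -> cdom c p -> g c p \in unitmx.
Proof.
move=> [_ _ _ gpos] cp; rewrite -row_free_unit.
apply: inj_row_free => u ug; apply/eqP/negPn/negP => /(gpos c p cp).
by rewrite /bil ug mul0mx mxE ltxx.
Qed.

(** The adjoint on the whole tangent space, for tangent vectors written as rows. The adjoint on ker
    eta arises from it by projection along [xi]. *)
Definition metric_adjoint (g F : @matrices R d M) : @matrices R d M :=
  fun c p => g c p *m (F c p)^T *m invmx (g c p).

Lemma tensor11_metric_adjoint W (g F : @matrices R d M) : open W ->
  riemannian_metric g -> tensor11 W F -> tensor11 W (metric_adjoint g F).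
Proof.
move=> oW hg [FJ FS]; have [gJ gS _ _] := hg; split; last first.
  move=> c; apply: smooth_mxM => //; last first.
    apply: smooth_invmx => // [p _ cp|i j]; first exact: metric_unitmx.
    exact: smooth_sub (gS c i j).
  apply: smooth_mxM => //; last exact: smooth_trmx.
  by move=> i j; exact: smooth_sub (gS c i j).
move=> c c' p Wp cp c'p; rewrite /metric_adjoint.
have gu := metric_unitmx hg cp; have gu' := metric_unitmx hg c'p.
set J := jac c c' p; have JK : J *m jac c' c p = 1%:M by rewrite jacK.
have KJ : jac c' c p *m J = 1%:M by rewrite jacK.
(* With K the inverse of J, the law g = J g' J^T inverts to g^-1 = K^T g'^-1 K; the remaining
   factors J^T and K^T then cancel. *)
have ginv : invmx (g c p) =
    (jac c' c p)^T *m invmx (g c' p) *m jac c' c p.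
  apply: mulmx1_invmx; rewrite (gJ c c') // -/J !mulmxA.
  rewrite -[X in X *m invmx _]mulmxA -trmx_mul KJ trmx1 mulmx1.
  by rewrite mulmxK.
rewrite ginv (gJ c c') // -/J -!mulmxA; congr (J *m (_ *m _)).
rewrite !mulmxA -trmx_mul FJ // -/J trmx_mul -!mulmxA.
by rewrite KJ mulmx1 !mulmxA -[X in X *m _]mulmxA -trmx_mul KJ trmx1 mulmx1.
Qed.

End TensorCalculus.

(** * Covectors and bilinear forms on one tangent space *)

Section PointwiseForms.
Context {R : realType} {d : nat}.
Implicit Types (a : 'cV[R]_d) (G F : 'M[R]_d) (u v w : 'rV[R]_d).

Lemma ev_linear a (k : R) u v : ev a (k *: u + v) = k * ev a u + ev a v.
Proof. by rewrite /ev mulmxDl -scalemxAl !mxE. Qed.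

Lemma evD a u v : ev a (u + v) = ev a u + ev a v.
Proof. by rewrite -[u]scale1r ev_linear mul1r scale1r. Qed.

Lemma ev0 a : ev a 0 = 0. Proof. by rewrite /ev mul0mx mxE. Qed.

Lemma evZ a k u : ev a (k *: u) = k * ev a u.
Proof. by rewrite -[_ *: _]addr0 ev_linear ev0 addr0. Qed.

Lemma evN a u : ev a (- u) = - ev a u.
Proof. by rewrite -scaleN1r evZ mulN1r. Qed.

Lemma evB a u v : ev a (u - v) = ev a u - ev a v.
Proof. by rewrite evD evN. Qed.

Lemma mulmx_outer a u w : u *m (a *m w) = ev a u *: w.
Proof. by rewrite mulmxA [u *m a]mx11_scalar mul_scalar_mx. Qed.

Lemma bilDl G u v w : bil G (u + v) w = bil G u w + bil G v w.
Proof. by rewrite /bil !mulmxDl mxE. Qed.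

Lemma bilDr G u v w : bil G u (v + w) = bil G u v + bil G u w.
Proof. by rewrite /bil raddfD mulmxDr mxE. Qed.

Lemma bilZl G (k : R) u v : bil G (k *: u) v = k * bil G u v.
Proof. by rewrite /bil -!scalemxAl mxE. Qed.

Lemma bilZr G (k : R) u v : bil G u (k *: v) = k * bil G u v.
Proof. by rewrite /bil linearZ -scalemxAr mxE. Qed.

Lemma bil0l G v : bil G 0 v = 0. Proof. by rewrite /bil !mul0mx mxE. Qed.

Lemma bil0r G v : bil G v 0 = 0. Proof. by rewrite /bil trmx0 mulmx0 mxE. Qed.

Lemma bilNl G u v : bil G (- u) v = - bil G u v.
Proof. by rewrite -scaleN1r bilZl mulN1r. Qed.

Lemma bilNr G u v : bil G u (- v) = - bil G u v.
Proof. by rewrite -scaleN1r bilZr mulN1r. Qed.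

Lemma bilBl G u v w : bil G (u - v) w = bil G u w - bil G v w.
Proof. by rewrite bilDl bilNl. Qed.

Lemma bil_trmx G u v : bil G^T u v = bil G v u.
Proof.
rewrite /bil; have -> : v *m G *m u^T = (u *m G^T *m v^T)^T.
  by rewrite !trmx_mul !trmxK mulmxA.
by rewrite [RHS]mxE.
Qed.

End PointwiseForms.

(** * Almost contact metric structures at a point *)

Section PointwiseContact.
Context {R : realType} {d : nat}.
Variables (phi G : 'M[R]_d) (xi : 'rV[R]_d) (eta : 'cV[R]_d).
Hypothesis phi2 : forall u, u *m phi *m phi = - u + ev eta u *: xi.
Hypothesis eta_xi : ev eta xi = 1.
Hypothesis G_phi : forall u v,
  bil G (u *m phi) (v *m phi) = bil G u v - ev eta u * ev eta v.
Hypothesis G_sym : G^T = G.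
Hypothesis G_pos : forall u, u != 0 -> 0 < bil G u u.
Implicit Types u v w : 'rV[R]_d.

Lemma bilC u v : bil G u v = bil G v u.
Proof. by rewrite -bil_trmx G_sym. Qed.

Lemma bil_eq0 u : bil G u u = 0 -> u = 0.
Proof. by move=> u0; apply/eqP/negPn/negP => /G_pos; rewrite u0 ltxx. Qed.

Lemma xi_neq0 : xi != 0.
Proof.
apply/eqP => xi0; move: eta_xi; rewrite xi0 ev0 => /eqP.
by rewrite eq_sym oner_eq0.
Qed.

(** By [phi2], phi^2 kills [xi]; applied to phi(xi), [phi2] then gives phi(xi) = k xi. Hence k^2 xi
    = 0, so k = 0. *)
Lemma xi_phi : xi *m phi = 0.
Proof.
have xi2 : xi *m phi *m phi = 0 by rewrite phi2 eta_xi scale1r addNr.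
have xiE : xi *m phi = ev eta (xi *m phi) *: xi.
  have := phi2 (xi *m phi); rewrite xi2 mul0mx => /eqP.
  by rewrite eq_sym addrC subr_eq0 => /eqP.
set k := ev eta _ in xiE; move: xi2; rewrite xiE -scalemxAl xiE scalerA.
move=> /eqP; rewrite scaler_eq0 (negPf xi_neq0) orbF mulf_eq0 orbb => /eqP ->.
by rewrite scale0r.
Qed.

(** Computing phi^3(u) as phi^2(phi(u)) and as phi(phi^2(u)) leaves eta(phi(u)) xi = 0. *)
Lemma eta_phi u : ev eta (u *m phi) = 0.
Proof.
have := phi2 (u *m phi); rewrite [u *m phi *m phi]phi2 mulmxDl mulNmx.
rewrite -scalemxAl xi_phi scaler0 addr0 => /eqP.
rewrite -subr_eq0 opprD addrA opprK addNr sub0r oppr_eq0.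
by rewrite scaler_eq0 (negPf xi_neq0) orbF => /eqP.
Qed.

(** This is [G_phi] at v = xi, whose left side vanishes by [xi_phi]. *)
Lemma etaE u : ev eta u = bil G u xi.
Proof.
have := G_phi u xi; rewrite xi_phi bil0r eta_xi mulr1 => /eqP.
by rewrite eq_sym subr_eq0 => /eqP.
Qed.

Lemma phi_surj u : ev eta u = 0 -> (- u *m phi) *m phi = u.
Proof. by move=> u0; rewrite phi2 evN u0 oppr0 scale0r addr0 opprK. Qed.

Let Q := 1%:M - eta *m xi.

Lemma mul_horizontal u : u *m Q = u - ev eta u *: xi.
Proof. by rewrite mulmxBr mulmx1 mulmx_outer. Qed.

Lemma ev_horizontal u : ev eta (u *m Q) = 0.
Proof. by rewrite mul_horizontal evB evZ eta_xi mulr1 subrr. Qed.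

Lemma horizontal_id u : ev eta u = 0 -> u *m Q = u.
Proof. by move=> u0; rewrite mul_horizontal u0 scale0r subr0. Qed.

Lemma bil_horizontal u v : ev eta v = 0 -> bil G (u *m Q) v = bil G u v.
Proof.
move=> v0; rewrite mul_horizontal bilBl bilZl [bil G xi v]bilC -etaE v0.
by rewrite mulr0 subr0.
Qed.

Lemma horizontal_inj u v : ev eta u = 0 -> ev eta v = 0 ->
  (forall w, ev eta w = 0 -> bil G u w = bil G v w) -> u = v.
Proof.
move=> u0 v0 uv; apply/eqP; rewrite -subr_eq0; apply/eqP/bil_eq0.
by rewrite bilBl uv ?subrr // evB u0 v0 subrr.
Qed.

Lemma G_unitmx : G \in unitmx.
Proof.
rewrite -row_free_unit; apply: inj_row_free => u uG; apply: bil_eq0.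
by rewrite /bil uG mul0mx mxE.
Qed.

Lemma bil_adjoint (A : 'M[R]_d) u v :
  bil G (u *m (G *m A^T *m invmx G)) v = bil G u (v *m A).
Proof. by rewrite /bil -!mulmxA mulKmx ?G_unitmx // trmx_mul !mulmxA. Qed.

Variable A : 'M[R]_d.
Variable N : 'M[R]_d.
Hypothesis N_A : forall u v,
  2 * bil N u v = bil G v (u *m A) - bil G u (v *m A).

(** Here [A] stands for nabla xi and [N] for d eta. The adjoint of [A] on the whole tangent space
    can have a component along [xi]; the last factor removes it. *)
Definition skew_mx : 'M[R]_d :=
  2^-1 *: ((A - G *m A^T *m invmx G) *m (1%:M - eta *m xi)).

Lemma skew_mx_horizontal u : ev eta (u *m skew_mx) = 0.
Proof. by rewrite /skew_mx -scalemxAr evZ mulmxA ev_horizontal mulr0. Qed.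

Lemma bil_skew_mx u v : ev eta v = 0 -> bil G (u *m skew_mx) v = bil N u v.
Proof.
move=> v0; rewrite -scalemxAr bilZl mulmxA bil_horizontal // mulmxBr bilBl.
rewrite bil_adjoint [bil G (u *m A) v]bilC -N_A mulrA.
by rewrite mulVf ?mul1r ?pnatr_eq0.
Qed.

Lemma bil_N_antisym u v : bil N u v = - bil N v u.
Proof.
have /eqP := N_A v u; rewrite -[_ - _]opprB -N_A -mulrN => /eqP /mulfI ->.
  by rewrite opprK.
by rewrite pnatr_eq0.
Qed.

(** The sum N(phi u, phi v) + N(u, v) is the G-product of the anticommutator at u with phi v,
    because phi is orthogonal on ker eta. By [phi_surj] such phi v exhaust ker eta, so the sum
    vanishes for all v only if the anticommutator does. *)
Lemma anti_invariantP :
  (forall u v, ev eta u = 0 -> ev eta v = 0 ->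
     bil N (u *m phi) (v *m phi) = - bil N u v) <->
  (forall u, ev eta u = 0 ->
     u *m phi *m skew_mx + u *m skew_mx *m phi = 0).
Proof.
have key u v : ev eta u = 0 -> ev eta v = 0 ->
    bil N (u *m phi) (v *m phi) + bil N u v =
    bil G (u *m phi *m skew_mx + u *m skew_mx *m phi) (v *m phi).
  move=> u0 v0; rewrite bilDl bil_skew_mx ?eta_phi // G_phi skew_mx_horizontal.
  by rewrite mul0r subr0 bil_skew_mx.
split=> [anti u u0|anti u v u0 v0].
  apply: horizontal_inj; rewrite ?ev0 //.
    by rewrite evD skew_mx_horizontal eta_phi addr0.
  move=> w w0; rewrite -(phi_surj w0) -key ?evN ?eta_phi ?oppr0 //.
  by rewrite anti ?eta_phi ?addNr ?bil0l.
by apply/eqP; rewrite -addr_eq0 key // anti // bil0l.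
Qed.

Hypothesis N_nondeg : forall u, ev eta u = 0 ->
  (forall v, ev eta v = 0 -> bil N u v = 0) -> u = 0.

(* The identity on the line of xi is added to make B an invertible matrix. *)
Definition skew_ext_mx : 'M[R]_d := (1%:M - eta *m xi) *m skew_mx + eta *m xi.

Lemma mul_skew_ext u :
  u *m skew_ext_mx = (u *m Q) *m skew_mx + ev eta u *: xi.
Proof. by rewrite /skew_ext_mx mulmxDr mulmx_outer mulmxA. Qed.

Lemma ev_skew_ext u : ev eta (u *m skew_ext_mx) = ev eta u.
Proof.
by rewrite mul_skew_ext evD skew_mx_horizontal evZ eta_xi mulr1 add0r.
Qed.

Lemma skew_ext_id u : ev eta u = 0 -> u *m skew_ext_mx = u *m skew_mx.
Proof. by move=> u0; rewrite mul_skew_ext u0 scale0r addr0 horizontal_id. Qed.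

(** The extension preserves the value of [eta], so its kernel lies in ker eta; there it pairs to
    zero under [N] with all of ker eta. *)
Lemma skew_ext_unitmx : skew_ext_mx \in unitmx.
Proof.
rewrite -row_free_unit; apply: inj_row_free => u uB.
have u0 : ev eta u = 0 by rewrite -ev_skew_ext uB ev0.
apply: N_nondeg => // v v0; rewrite -bil_skew_mx //.
by rewrite -skew_ext_id // uB bil0l.
Qed.

End PointwiseContact.

(** * The Levi-Civita connection and d eta *)

Section Connection.
Context {R : realType} {d : nat} {M : manifold R d}.

Lemma eq_dirder (c : chart M) (W : set M) (f h : M -> R) (p : M) u :
  open W -> W p -> cdom c p ->
  (forall q, W q -> cdom c q -> f q = h q) ->
  dirder c u f p = dirder c u h p.
Proof.
move=> oW Wp cp fh; congr (ev _ _); apply/colP => i; rewrite !mxE.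
exact: eq_pd fh.
Qed.

Lemma dirder_cst (c : chart M) (k : R) (p : M) u :
  dirder c u (fun=> k) p = 0.
Proof.
rewrite /dirder [diff_fun _ _ _](_ : _ = 0); first by rewrite /ev mulmx0 mxE.
by apply/colP => i; rewrite !mxE /pd /partial derive_cst.
Qed.

Variables (phi : @matrices R d M) (xi : @vectors R d M).
Variables (eta : @covectors R d M) (g : @matrices R d M).
Variable nabla : @vectors R d M -> @matrices R d M.
Hypothesis acm : almost_contact_metric phi xi eta g.
Hypothesis lc : levi_civita g nabla.

Lemma acm_phi2 c p (cp : cdom c p) u :
  u *m phi c p *m phi c p = - u + ev (eta c p) u *: xi c p.
Proof. by have [_ /(_ c p cp)[]] := acm. Qed.

Lemma acm_eta_xi c p (cp : cdom c p) : ev (eta c p) (xi c p) = 1.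
Proof. by have [_ /(_ c p cp)[]] := acm. Qed.

Lemma acm_g_phi c p (cp : cdom c p) u v :
  bil (g c p) (u *m phi c p) (v *m phi c p) =
  bil (g c p) u v - ev (eta c p) u * ev (eta c p) v.
Proof. by have [_ /(_ c p cp)[]] := acm. Qed.

Lemma acm_g_sym c p (cp : cdom c p) : (g c p)^T = g c p.
Proof. by have [[_ _ _ [_ _ gs _]] _] := acm; exact: gs. Qed.

Lemma acm_g_pos c p (cp : cdom c p) u : u != 0 -> 0 < bil (g c p) u u.
Proof. by have [[_ _ _ [_ _ _ gp]] _] := acm; exact: gp. Qed.

Lemma acm_etaE c p (cp : cdom c p) u :
  ev (eta c p) u = bil (g c p) u (xi c p).
Proof. exact: etaE (acm_phi2 cp) (acm_eta_xi cp) (acm_g_phi cp) u. Qed.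

Lemma xi_field W : vector_field W xi.
Proof. by have [[_ xiT _ _] _] := acm; apply: vector_field_sub xiT. Qed.

Lemma nabla_xi_tensor : tensor11 setT (nabla xi).
Proof.
have [[tens _ _ _] _ _] := lc; apply: tens; first exact: openT.
exact: xi_field.
Qed.

(** Differentiating g(xi, xi) = 1 along a field extending [u] gives 2 g(nabla_u xi, xi) = 0. *)
Lemma nabla_xi_horizontal c p (cp : cdom c p) u :
  ev (eta c p) (u *m nabla xi c p) = 0.
Proof.
have [_ _ metr] := lc.
have := metr _ _ _ _ (cdom_open c) (const_field_vector_field c u)
  (xi_field _) (xi_field _) c p cp cp.
rewrite const_fieldE // (eq_dirder (h := fun=> 1) _ (cdom_open c) cp cp).
  rewrite dirder_cst acm_etaE // (bilC (acm_g_sym cp) (xi c p)) -mulr2n.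
  by move/eqP; rewrite eq_sym mulrn_eq0 /= => /eqP.
by move=> q cq _; rewrite -acm_etaE // acm_eta_xi.
Qed.

(** Extend [u] and [v] to fields X and Y constant in the chart. Since eta = g(_, xi), metric
    compatibility expands X(eta(Y)) and Y(eta(X)); the terms with nabla X and nabla Y cancel against
    eta([X, Y]) because the torsion vanishes. *)
Lemma ext_d_nabla c p (cp : cdom c p) u v :
  2 * bil (ext_d eta c p) u v =
  bil (g c p) v (u *m nabla xi c p) - bil (g c p) u (v *m nabla xi c p).
Proof.
have [_ tors metr] := lc.
have [[_ _ [etaJ etaS] _] _] := acm.
have oc := cdom_open c.
have eta_c : one_form (cdom c) eta.
  split=> [c1 c2 q _|c1 j]; first exact: etaJ.
  by apply: smooth_sub (etaS c1 j).
have X := const_field_vector_field c u; have Y := const_field_vector_field c v.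
have derE w z : dirder c w (fun q => ev (eta c q) (const_field c z c q)) p =
    bil (g c p) (w *m nabla (const_field c z) c p) (xi c p) +
    bil (g c p) z (w *m nabla xi c p).
  have := metr _ _ _ _ oc (const_field_vector_field c w)
    (const_field_vector_field c z) (xi_field _) c p cp cp.
  rewrite !const_fieldE // => <-; apply: (eq_dirder _ oc) => // q cq _.
  exact: acm_etaE.
have := ext_dE eta_c X Y cp cp; rewrite -(tors _ _ _ oc X Y c p cp cp).
rewrite !const_fieldE // => ->; rewrite !derE evB !acm_etaE //.
ring.
Qed.

End Connection.

(** * Wedge products and nondegeneracy of d eta on ker eta *)

Section AlternatingForms.
Context {R : realType} {d : nat}.

Definition upd k (v : 'I_k -> 'rV[R]_d) (i : 'I_k) x : 'I_k -> 'rV[R]_d :=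
  fun j => if j == i then x else v j.

Definition multilinear k (f : @form R d k) :=
  forall v i (a : R) (x y : 'rV[R]_d),
    f (upd v i (a *: x + y)) = a * f (upd v i x) + f (upd v i y).

Definition alternating k (f : @form R d k) :=
  forall v i j, i != j -> v i = v j -> f v = 0.

Lemma upd_id k (v : 'I_k -> 'rV[R]_d) i : upd v i (v i) = v.
Proof. by apply/funext => j; rewrite /upd; case: eqP => [->|]. Qed.

Lemma upd_comp k l (h : 'I_l -> 'I_k) (v : 'I_k -> 'rV[R]_d) i x :
  injective h -> (fun j => upd v (h i) x (h j)) = upd (fun j => v (h j)) i x.
Proof. by move=> hI; apply/funext => j; rewrite /upd (inj_eq hI). Qed.

Lemma upd_outside k l (h : 'I_l -> 'I_k) (v : 'I_k -> 'rV[R]_d) i x :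
  (forall j, h j != i) -> (fun j => upd v i x (h j)) = (fun j => v (h j)).
Proof. by move=> hi; apply/funext => j; rewrite /upd (negPf (hi j)). Qed.

Lemma perm_split k l (s : 'S_(k + l)) x :
  (exists j, x = s (lshift l j)) \/ (exists j, x = s (rshift k j)).
Proof.
rewrite -[x](permKV s); case: (split_ordP (s^-1%g x)) => j ->; [left|right];
  by exists j.
Qed.

Lemma perm_lr k l (s : 'S_(k + l)) i j :
  (s (lshift l i) == s (rshift k j)) = false.
Proof. by rewrite (inj_eq perm_inj) eq_lrshift. Qed.

Lemma perm_rl k l (s : 'S_(k + l)) i j :
  (s (rshift k j) == s (lshift l i)) = false.
Proof. by rewrite eq_sym perm_lr. Qed.

Lemma perm_lshift_inj k l (s : 'S_(k + l)) :
  injective (fun i => s (lshift l i)).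
Proof. by move=> i j /perm_inj /lshift_inj. Qed.

Lemma perm_rshift_inj k l (s : 'S_(k + l)) :
  injective (fun i => s (rshift k i)).
Proof. by move=> i j /perm_inj /rshift_inj. Qed.

(** The sum over all permutations antisymmetrizes any [a] and [b]: composing with the transposition
    of [i] and [j] flips every sign but no argument, so the sum is its own negative. *)
Lemma wedge_alternating k l (a : @form R d k) (b : @form R d l) :
  alternating (wedge a b).
Proof.
move=> v i j ij vij; rewrite /wedge; set S := \sum_(s : _) _.
have vt x : v (tperm i j x) = v x by case: tpermP => [->|->|].
have SN : S = - S.
  rewrite {1}/S (reindex_inj (mulIg (tperm i j))) /= -sumrN.
  apply: eq_bigr => s _; rewrite odd_permM odd_tperm ij signr_addb mulrN1.
  rewrite -mulNr; congr (_ * (a _ * b _)); apply/funext => x;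
    by rewrite permM vt.
have /eqP : S *+ 2 = 0 by rewrite mulr2n {1}SN addNr.
by rewrite mulrn_eq0 /= => /eqP ->; rewrite mulr0.
Qed.

(** In each summand, argument [i] enters exactly one of the two factors. *)
Lemma wedge_multilinear k l (a : @form R d k) (b : @form R d l) :
  multilinear a -> multilinear b -> multilinear (wedge a b).
Proof.
move=> am bm v i t x y; rewrite /wedge (mulrCA t) -mulrDr; congr (_ * _).
rewrite mulr_sumr -big_split /=; apply: eq_bigr => s _.
rewrite (mulrCA t) -mulrDr; congr (_ * _).
case: (perm_split s i) => -[j ->].
  rewrite !(upd_comp _ _ _ (perm_lshift_inj (s := s))).
  rewrite !(upd_outside (h := fun i => s (rshift k i)));
    try by move=> ?; rewrite perm_rl.
  by rewrite am mulrDl mulrA.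
rewrite !(upd_comp _ _ _ (perm_rshift_inj (s := s))).
rewrite !(upd_outside (h := fun i => s (lshift l i)));
  try by move=> ?; rewrite perm_lr.
by rewrite bm mulrDr mulrCA.
Qed.

Lemma form_of_covector_multilinear (eta : 'cV[R]_d) :
  multilinear (form_of_covector eta).
Proof.
by move=> v i a x y; rewrite /form_of_covector /upd (ord1 i) /= ev_linear.
Qed.

Lemma form_of_matrix_multilinear (N : 'M[R]_d) : multilinear (form_of_matrix N).
Proof.
move=> v i a x y; rewrite /form_of_matrix /upd.
case: i => -[|[|//]] i2; rewrite -!val_eqE /=.
  by rewrite bilDl bilZl.
by rewrite bilDr bilZr.
Qed.

Lemma wedge_exp_multilinear (b : @form R d 2) m :
  multilinear b -> multilinear (@wedge_exp R d b m).
Proof.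
move=> bm; elim: m => [|m IH]; first by move=> v [].
exact: wedge_multilinear.
Qed.

Lemma multilinear_sum k (f : @form R d k) v i n (a : 'I_n -> R) x :
  multilinear f ->
  f (upd v i (\sum_j a j *: x j)) = \sum_j a j * f (upd v i (x j)).
Proof.
move=> fm; have f0 : f (upd v i 0) = 0.
  have := fm v i 1 0 0; rewrite scaler0 addr0 mul1r => /eqP.
  by rewrite -subr_eq0 opprD addrA subrr sub0r oppr_eq0 => /eqP.
elim/big_rec2: _ => // j y z _ <-.
by rewrite fm.
Qed.

(** In each summand [v i] either enters the first factor, where it is paired with another argument,
    or falls to the remaining power, handled by induction. For m = 0 there is no index [i]. *)
Lemma wedge_exp_eq0 (N : 'M[R]_d) m v i :
  (forall j, j != i -> bil N (v i) (v j) = 0 /\ bil N (v j) (v i) = 0) ->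
  wedge_exp (form_of_matrix N) (m := m) v = 0.
Proof.
elim: m v i => [|m IH] v i vi; first by case: i {vi}.
rewrite /= /wedge big1 ?mulr0 // => s _.
case: (perm_split s i) => -[j ij].
  have sN (h : 'I_2) : h != j -> s (lshift (m * 2) h) != i.
    by apply: contra => /eqP; rewrite ij => /perm_lshift_inj ->.
  suff -> : form_of_matrix N (fun x => v (s (lshift (m * 2) x))) = 0.
    by rewrite mul0r mulr0.
  rewrite /form_of_matrix; have [j0|j0] := eqVneq j ord0.
    rewrite -j0 -ij; apply: (vi _ _).1; apply: sN.
    by rewrite j0 -val_eqE.
  have <- : j = ord_max by apply/val_inj; case: j j0 {ij sN} => -[|[|]].
  by rewrite -ij; apply: (vi _ _).2; apply: sN; rewrite eq_sym.
rewrite (IH _ j) ?mulr0 // => h hj; rewrite -ij; apply: vi.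
by apply: contra hj => /eqP; rewrite ij => /perm_rshift_inj ->.
Qed.

(* Subtracting from one argument outside ker eta a multiple of another one
   reduces to at most one argument outside ker eta. *)
Lemma wedge_covector_eq0 (eta : 'cV[R]_d) (N : 'M[R]_d) m v i :
  (forall x y, bil N x y = - bil N y x) ->
  ev eta (v i) = 0 -> (forall x, ev eta x = 0 -> bil N (v i) x = 0) ->
  wedge (form_of_covector eta) (wedge_exp (form_of_matrix N) (m := m)) v = 0.
Proof.
move=> Nskew.
have [n] := ubnP #|[pred j | ev eta (v j) != 0]|.
elim: n v => // n IH v; rewrite ltnS => vn vi0 viN.
have [/existsP[j0 /existsP[j1 /and3P[j01 vj0 vj1]]]|] :=
  boolP [exists j0, exists j1,
    [&& j0 != j1, ev eta (v j0) != 0 & ev eta (v j1) != 0]].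
  set c := ev eta (v j1) / ev eta (v j0).
  have ij1 : i != j1 by apply: contra_neq vj1 => <-.
  set w := upd v j1 ((- c) *: v j0 + v j1).
  have wi : w i = v i by rewrite /w /upd (negPf ij1).
  have wj1 : ev eta (w j1) = 0.
    by rewrite /w /upd eqxx ev_linear /c mulNr divfK // addNr.
  have : wedge (form_of_covector eta)
      (wedge_exp (form_of_matrix N) (m := m)) w = 0.
    apply: IH; rewrite ?wi //; apply: leq_trans vn; apply: proper_card.
    apply/properP; split; last by exists j1; rewrite inE // wj1 eqxx.
    apply/fintype.subsetP => j; rewrite !inE; have [->|] := eqVneq j j1.
      by rewrite wj1 eqxx.
    by rewrite /w /upd => /negPf ->.
  have fm := wedge_multilinear (form_of_covector_multilinear eta)
    (wedge_exp_multilinear (m := m) (form_of_matrix_multilinear N)).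
  (* Linearity in slot [j1] expands the value at [w]; the term containing [v j0] twice vanishes, so
     the value at [v] is the one at [w]. *)
  rewrite fm upd_id (wedge_alternating _ _ j01) ?mulr0 ?add0r //.
  by rewrite /upd eqxx (negPf j01).
rewrite negb_exists => /forallP v1.
rewrite /wedge big1 ?mulr0 // => s _; rewrite /form_of_covector.
set j0 := s (lshift _ _).
(* Either [eta] kills its own argument [v j0], or all other arguments lie in ker eta; then [v i] is
   among them and makes the power of [N] vanish. *)
have [->|vj0] := eqVneq (ev eta (v j0)) 0; first by rewrite mul0r mulr0.
have vD j : j != j0 -> ev eta (v j) = 0.
  move=> jj0; apply/eqP; have := v1 j0; rewrite negb_exists => /forallP/(_ j).
  by rewrite eq_sym jj0 vj0 /= negbK.
case: (perm_split s i) => -[j ij].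
  have i0 : i = j0 by rewrite ij (ord1 j).
  by move: vj0; rewrite -i0 vi0 eqxx.
rewrite (wedge_exp_eq0 (i := j)) ?mulr0 // => h hj; rewrite -ij.
have N0 : bil N (v i) (v (s (rshift 1 h))) = 0.
  by apply: viN; apply: vD; rewrite perm_rl.
by split=> //; rewrite Nskew N0 oppr0.
Qed.

(** Since the form is nonzero at [v], the vectors of [v] are independent, and by their number they
    form a basis. Putting [u] in slot i multiplies the value by the i-th coordinate of [u], yet
    gives 0 by [wedge_covector_eq0]; so all coordinates vanish. *)
Lemma wedge_covector_nondegenerate (eta : 'cV[R]_d) (N : 'M[R]_d) m v u :
  d = (1 + m * 2)%N -> (forall x y, bil N x y = - bil N y x) ->
  wedge (form_of_covector eta) (wedge_exp (form_of_matrix N) (m := m)) v <> 0 ->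
  ev eta u = 0 -> (forall x, ev eta x = 0 -> bil N u x = 0) -> u = 0.
Proof.
move=> dm Nskew; set f := wedge _ _ => fv u0 uN.
have fm : multilinear f.
  apply: wedge_multilinear; first exact: form_of_covector_multilinear.
  exact/wedge_exp_multilinear/form_of_matrix_multilinear.
have falt : alternating f by exact: wedge_alternating.
have fE (a : 'rV[R]_(1 + m * 2)) i :
    f (upd v i (a *m \matrix_j v j)) = a 0 i * f v.
  rewrite mulmx_sum_row multilinear_sum // (bigD1 i) //= rowK upd_id.
  rewrite big1 ?addr0 //.
  move=> j ji; rewrite rowK (falt _ i j) ?mulr0 1?eq_sym //.
  by rewrite /upd eqxx (negPf ji).
have coef0 (a : 'rV[R]_(1 + m * 2)) :
    (forall i, f (upd v i (a *m \matrix_j v j)) = 0) -> a = 0.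
  move=> fa; apply/rowP => i; rewrite mxE; apply/eqP.
  by have /eqP := fa i; rewrite fE mulf_eq0 => /orP[//|/eqP/fv].
have Vfree : row_free (\matrix_j v j).
  apply: inj_row_free => a aV; apply: coef0 => i.
  by rewrite aV -(mul0mx _ (\matrix_j v j)) fE mxE mul0r.
have Vfull : row_full (\matrix_j v j) by rewrite /row_full (eqP Vfree) -dm.
have /submxP[a ua] := submx_full u Vfull.
rewrite ua (coef0 a) ?mul0mx // => i; rewrite -ua.
by apply: (wedge_covector_eq0 (i := i)) => //; rewrite /upd eqxx.
Qed.

End AlternatingForms.

(** * Parity of the eigenspaces of phi *)

(** Compare det K = det K^T = (-1)^n det K. *)
Lemma skew_unitmx_even (F : fieldType) n (K : 'M[F]_n) :
  (2 : F) != 0 -> K^T = - K -> K \in unitmx -> ~~ odd n.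
Proof.
move=> F2 KT; rewrite unitmxE unitfE => dK; apply/negP => on.
have := det_tr K; rewrite KT -scaleN1r detZ -signr_odd on expr1 mulN1r => /eqP.
by rewrite eq_sym -addr_eq0 -mulr2n -mulr_natl mulf_eq0 (negPf F2) (negPf dK).
Qed.

Section ContactEigenspaces.
Context {F : fieldType} {n : nat}.

Variables (phi N : 'M[F]_n) (xi : 'rV[F]_n) (eta : 'cV[F]_n) (i : F).
Let Q := 1%:M - eta *m xi.
Hypothesis F2 : (2 : F) != 0.
Hypothesis i2 : i * i = -1.
Hypothesis xi_eta : xi *m eta = 1%:M.
Hypothesis phi2 : phi *m phi = - Q.
Hypothesis xi_phi : xi *m phi = 0.
Hypothesis phi_eta : phi *m eta = 0.

Let i_neq0 : i != 0.
Proof.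
apply/eqP => i0; move/eqP: i2.
by rewrite i0 mul0r eq_sym oppr_eq0 oner_eq0.
Qed.

Let Q_phi : Q *m phi = phi.
Proof. by rewrite mulmxBl mul1mx -mulmxA xi_phi mulmx0 subr0. Qed.

Let xi_Q : xi *m Q = 0.
Proof. by rewrite mulmxBr mulmx1 mulmxA xi_eta mul1mx subrr. Qed.

Let eigen_horizontal m (w : 'M[F]_(m, n)) (a : F) :
  a != 0 -> w *m phi = a *: w -> w *m eta = 0.
Proof.
move=> a0 wa; apply/eqP; rewrite -(inj_eq (scalerI a0)) scaler0 scalemxAl -wa.
by rewrite -mulmxA phi_eta mulmx0.
Qed.

(** The matrix Q - a phi is twice the projection onto the eigenspace for [a]. *)
Lemma eigen_half (a : F) : a * a = -1 -> (Q - a *: phi <= eigenspace phi a)%MS.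
Proof.
move=> a2; apply/eigenspaceP.
rewrite mulmxBl Q_phi -scalemxAl phi2 scalerBr scalerA a2.
rewrite scaleN1r scalerN !opprK.
exact: addrC.
Qed.

Let iN2 : (- i) * (- i) = -1. Proof. by rewrite mulrNN. Qed.

(** Eigenvectors for a nonzero eigenvalue lie in the image of phi, hence in ker eta, the row space
    of [Q]. Conversely [Q] is half the sum of Q - i phi and Q + i phi. *)
Lemma horizontal_eigenspaces :
  (eigenspace phi i + eigenspace phi (- i) :=: Q)%MS.
Proof.
apply/eqmxP/andP; split.
  have sub a : a != 0 -> (eigenspace phi a <= Q)%MS.
    move=> a0; set E := eigenspace phi a.
    have E0 : E *m eta = 0.
      by apply: (eigen_horizontal (a := a)) => //; apply/eigenspaceP.
    rewrite -[E](_ : E *m Q = E) ?submxMl //.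
    by rewrite mulmxBr mulmx1 mulmxA E0 mul0mx subr0.
  by rewrite addsmx_sub !sub ?oppr_eq0.
have -> : Q = 2^-1 *: ((Q - i *: phi) + (Q - (- i) *: phi)).
  rewrite scaleNr opprK addrACA addNr addr0 -mulr2n -scaler_nat scalerA.
  by rewrite mulVf ?scale1r.
apply: scalemx_sub; apply: addmx_sub_adds; exact: eigen_half.
Qed.

Lemma rank_horizontal : (\rank Q).+1 = n.
Proof.
have xi0 : xi != 0.
  apply/eqP => xi0; move: xi_eta; rewrite xi0 mul0mx => /matrixP/(_ 0 0)/eqP.
  by rewrite !mxE eq_sym oner_eq0.
have kQ : (kermx Q :=: xi)%MS.
  apply/eqmxP/andP; split; last by apply/sub_kermxP.
  have /eqP := mulmx_ker Q; rewrite mulmxBr mulmx1 subr_eq0 mulmxA => /eqP ->.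
  exact: submxMl.
have := mxrank_ker Q; rewrite kQ rank_rV xi0 => n1.
by rewrite -[RHS](subnK (rank_leq_row Q)) -n1 addnC addn1.
Qed.

Lemma rank_eigenspaces :
  (\rank (eigenspace phi i) + \rank (eigenspace phi (- i))).+1 = n.
Proof.
rewrite -mxrank_sum_cap horizontal_eigenspaces.
rewrite [(_ :&: _)%MS](_ : _ = 0) ?mxrank0 ?addn0 ?rank_horizontal //.
set V := (_ :&: _)%MS.
have Vi : V *m phi = i *: V by apply/eigenspaceP; exact: capmxSl.
have : V *m phi = - i *: V by apply/eigenspaceP; exact: capmxSr.
rewrite Vi scaleNr => /eqP; rewrite -addr_eq0 -mulr2n -scaler_nat scalerA.
by rewrite scaler_eq0 mulf_eq0 (negPf F2) (negPf i_neq0) => /eqP.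
Qed.

Hypothesis phi_N : phi *m N = N *m phi^T.
Hypothesis N_skew : N^T = - N.
Hypothesis xi_N : xi *m N = 0.
Hypothesis N_unit : N + eta *m eta^T \in unitmx.

(* The eigenspaces of phi for i and -i are N-orthogonal, so the skew form N
   restricts to a nondegenerate one on each of them. *)
Lemma eigenspace_even : ~~ odd (\rank (eigenspace phi i)).
Proof.
move: (row_base_free (eigenspace phi i)) (eq_row_base (eigenspace phi i)).
set r := \rank _; move: (row_base _) => P Pfree PE.
have Pphi : P *m phi = i *: P by apply/eigenspaceP; rewrite PE.
(* The rows of [P] are a basis of the eigenspace, and K is the Gram matrix of [N] in it. A vector
   [a] in the kernel of K gives an eigenvector [w] that is N-orthogonal to the eigenspace. *)
apply: (skew_unitmx_even (K := P *m N *m P^T)) => //.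
  by rewrite !trmx_mul trmxK N_skew mulNmx mulmxN mulmxA.
rewrite -row_free_unit; apply: inj_row_free => a.
rewrite !mulmxA; set w := a *m P => wNP.
have wphi : w *m phi = i *: w by rewrite -mulmxA Pphi -scalemxAr.
have wplus : w *m N *m (Q - i *: phi)^T = 0.
  have /submxP[S ->] : (Q - i *: phi <= P)%MS by rewrite PE eigen_half.
  by rewrite trmx_mul mulmxA wNP mul0mx.
have wminus : w *m N *m (Q - (- i) *: phi)^T = 0.
  set E := Q - _; have Ephi : E *m phi = - i *: E.
    by apply/eigenspaceP; exact: eigen_half iN2.
  (* Moving phi across [N] trades the eigenvalue i of [w] for the eigenvalue -i of the rows of
     [E]. *)
  have : i *: (w *m N *m E^T) = - (i *: (w *m N *m E^T)).
    have EphiT : phi^T *m E^T = - i *: E^T by rewrite -trmx_mul Ephi linearZ.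
    rewrite -[RHS]scaleNr [RHS]scalemxAr -EphiT mulmxA.
    by rewrite -(mulmxA w N phi^T) -phi_N mulmxA wphi -!scalemxAl.
  move=> /eqP; rewrite -addr_eq0 -mulr2n -scaler_nat scalerA.
  by rewrite scaler_eq0 mulf_eq0 (negPf F2) (negPf i_neq0) => /eqP.
have wQ : w *m N *m Q^T = 0.
  have : w *m N *m ((Q - i *: phi) + (Q - (- i) *: phi))^T = 0.
    by rewrite linearD mulmxDr wplus wminus addr0.
  rewrite scaleNr opprK addrACA addNr addr0 -mulr2n -scaler_nat linearZ.
  by rewrite -scalemxAr => /eqP; rewrite scaler_eq0 (negPf F2) => /eqP.
have N_xi : N *m xi^T = 0.
  by rewrite -[N]trmxK -trmx_mul N_skew mulmxN xi_N oppr0 trmx0.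
have wN : w *m N = 0.
  move: wQ; rewrite /Q linearB /= trmx1 mulmxBr mulmx1 trmx_mul mulmxA.
  by rewrite -(mulmxA w) N_xi mulmx0 mul0mx subr0.
(* As an eigenvector [w] is also killed by [eta], so it lies in the kernel of the invertible N + eta
   eta^T. *)
have w0 : w = 0.
  apply: (can_inj (mulmxK N_unit)); rewrite mul0mx mulmxDr wN add0r mulmxA.
  by rewrite (eigen_horizontal i_neq0 wphi) mul0mx.
by apply/eqP; rewrite -(mulmx_free_eq0 a Pfree) -/w w0.
Qed.

End ContactEigenspaces.

(** * The dimension of M *)

Section Dimension.
Context {R : realType} {d : nat}.

Lemma eq_mulmxr m n (A B : 'M[R]_(m, n)) :
  (forall u : 'rV[R]_m, u *m A = u *m B) -> A = B.
Proof. by move=> AB; apply/row_matrixP => i; rewrite !rowE. Qed.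

Lemma eq_bil (A B : 'M[R]_d) : (forall u v, bil A u v = bil B u v) -> A = B.
Proof.
move=> AB; apply: eq_mulmxr => u; apply: (can_inj trmxK).
apply: eq_mulmxr => v; apply/matrixP => i j; rewrite !ord1.
by rewrite -[v]trmxK -!trmx_mul !mxE; have := AB u v; rewrite /bil !mxE.
Qed.

Variables (phi N : 'M[R]_d) (xi : 'rV[R]_d) (eta : 'cV[R]_d).
Let Q := 1%:M - eta *m xi.
Hypothesis phi2 : forall u, u *m phi *m phi = - u + ev eta u *: xi.
Hypothesis eta_xi : ev eta xi = 1.
Hypothesis xi_phi : xi *m phi = 0.
Hypothesis eta_phi : forall u, ev eta (u *m phi) = 0.
Hypothesis N_skew : forall u v, bil N u v = - bil N v u.
Hypothesis N_anti : forall u v, ev eta u = 0 -> ev eta v = 0 ->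
  bil N (u *m phi) (v *m phi) = - bil N u v.
Hypothesis N_nondeg : forall u, ev eta u = 0 ->
  (forall v, ev eta v = 0 -> bil N u v = 0) -> u = 0.

(** As [xi] need not be the Reeb field, d eta may be nonzero on it. Compressing to ker eta keeps the
    values there and puts [xi] in the kernel. *)
Let N' := Q *m N *m Q^T.

Let bil_N' u v : bil N' u v = bil N (u *m Q) (v *m Q).
Proof. by rewrite /bil /N' trmx_mul !mulmxA. Qed.

Let phiQ (u : 'rV[R]_d) : u *m phi *m Q = u *m phi.
Proof. by rewrite horizontal_id // eta_phi. Qed.

Let Qphi (u : 'rV[R]_d) : u *m Q *m phi = u *m phi.
Proof. by rewrite mul_horizontal mulmxBl -scalemxAl xi_phi scaler0 subr0. Qed.

Let Q0 (u : 'rV[R]_d) : ev eta (u *m Q) = 0. Proof. exact: ev_horizontal. Qed.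

Let xi_eta : xi *m eta = 1%:M.
Proof. by rewrite [LHS]mx11_scalar -/(ev eta xi) eta_xi. Qed.

Let phi_sq : phi *m phi = - Q.
Proof.
apply: eq_mulmxr => u; rewrite mulmxA phi2 mulmxN mul_horizontal opprB.
exact: addrC.
Qed.

Let phi_eta : phi *m eta = 0.
Proof.
apply: eq_mulmxr => u; rewrite mulmxA mulmx0 [LHS]mx11_scalar.
by rewrite -/(ev eta (u *m phi)) eta_phi raddf0.
Qed.

(** Write the horizontal part of v as -phi^2(v) and apply anti-invariance to the horizontal part of
    u and phi(v). *)
Let phi_N : phi *m N' = N' *m phi^T.
Proof.
apply: eq_bil => u v.
rewrite [LHS](_ : _ = bil N' (u *m phi) v); last by rewrite /bil mulmxA.
rewrite [RHS](_ : _ = bil N' u (v *m phi)); last first.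
  by rewrite /bil trmx_mul !mulmxA.
rewrite !bil_N' !phiQ -(Qphi u).
have -> : v *m Q = - (v *m phi *m phi) by rewrite -mulmxA phi_sq mulmxN opprK.
by rewrite bilNr N_anti ?opprK.
Qed.

Let N'_skew : N'^T = - N'.
Proof.
apply: eq_bil => u v; rewrite bil_trmx !bil_N' N_skew -bil_N'.
by rewrite /bil mulmxN mulNmx [RHS]mxE.
Qed.

Let xi_N' : xi *m N' = 0.
Proof.
by rewrite /N' !mulmxA mulmxBr mulmx1 mulmxA xi_eta mul1mx subrr !mul0mx.
Qed.

(** The added term makes the form nondegenerate along [xi]: pairing a kernel vector with [xi] leaves
    eta(u) = 0, and [N_nondeg] applies on ker eta. *)
Let N'_unit : N' + eta *m eta^T \in unitmx.
Proof.
rewrite -row_free_unit; apply: inj_row_free => u.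
rewrite mulmxDr mulmx_outer => uN.
have u0 : ev eta u = 0.
  have : (u *m N' + ev eta u *: eta^T) *m xi^T = 0 by rewrite uN mul0mx.
  rewrite mulmxDl -scalemxAl -trmx_mul xi_eta trmx1.
  have -> : u *m N' *m xi^T = 0.
    rewrite -mulmxA -[N']trmxK -trmx_mul N'_skew mulmxN xi_N'.
    by rewrite oppr0 trmx0 mulmx0.
  by rewrite add0r => /matrixP/(_ 0 0); rewrite !mxE eqxx mulr1.
move: uN; rewrite u0 scale0r addr0 => uN.
apply: N_nondeg => // v v0.
rewrite -(horizontal_id xi u0) -(horizontal_id xi v0) -bil_N'.
by rewrite /bil uN mul0mx mxE.
Qed.

Lemma dim_anti_invariant : exists n, d = (4 * n + 1)%N.
Proof.
pose f : {rmorphism R -> R[i]} := real_complex R.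
pose phiC := map_mx f phi.
pose cj : {rmorphism R[i] -> R[i]} := @conjc R.
have [i ii cji] : exists2 i : R[i], i * i = -1 & cj i = - i.
  exists 'i%C; first by rewrite -expr2 sqr_i.
  by rewrite /cj /=; congr Complex; rewrite oppr0.
have two : (2 : R[i]) != 0 by rewrite pnatr_eq0.
have cxi : map_mx f xi *m map_mx f eta = 1%:M.
  by rewrite -map_mxM xi_eta map_mx1.
have cphi2 : phiC *m phiC = - (1%:M - map_mx f eta *m map_mx f xi).
  by rewrite /phiC -map_mxM phi_sq map_mxN map_mxB map_mx1 map_mxM.
have cxiphi : map_mx f xi *m phiC = 0 by rewrite /phiC -map_mxM xi_phi map_mx0.
have cphieta : phiC *m map_mx f eta = 0.
  by rewrite /phiC -map_mxM phi_eta map_mx0.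
have rk := rank_eigenspaces two ii cxi cphi2 cxiphi cphieta.
have ev2 : ~~ odd (\rank (eigenspace phiC i)).
  apply: (eigenspace_even (N := map_mx f N') two ii cphi2 cxiphi cphieta).
  - by rewrite /phiC map_trmx -!map_mxM phi_N.
  - by rewrite map_trmx N'_skew map_mxN.
  - by rewrite -map_mxM xi_N' map_mx0.
  - by rewrite map_trmx -map_mxM -map_mxD map_unitmx.
(* Since phi is real, conjugating entries carries the eigenspace for i to the one for -i. *)
have conjr : \rank (eigenspace phiC (- i)) = \rank (eigenspace phiC i).
  have cjphi : map_mx cj phiC = phiC.
    by apply/matrixP => j k; rewrite !mxE; exact: conjc_real.
  by rewrite -cji -{1}cjphi -map_eigenspace mxrank_map.
(* The dimension is 2r + 1 with r even, so n is r / 2. *)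
have arith (r s : nat) : (r + s).+1 = d -> s = r -> ~~ odd r ->
    exists n, d = (4 * n + 1)%N.
  move=> <- -> /even_halfK rE; exists r./2.
  by rewrite addn1 -{1 2}rE -!muln2 -mulnDr [in RHS]mulnC.
exact: arith rk conjr ev2.
Qed.

End Dimension.

(** * The endomorphism B of the contact distribution *)

Section ContactB.
Context {R : realType} {d : nat} {M : manifold R d}.
Variables (phi : @matrices R d M) (xi : @vectors R d M).
Variables (eta : @covectors R d M) (g : @matrices R d M).
Variable nabla : @vectors R d M -> @matrices R d M.
Hypothesis acm : almost_contact_metric phi xi eta g.
Hypothesis lc : levi_civita g nabla.
Hypothesis cf : contact_form eta.

Lemma contact_eta_phi c p (cp : cdom c p) u : ev (eta c p) (u *m phi c p) = 0.
Proof. exact: eta_phi (acm_phi2 acm cp) (acm_eta_xi acm cp) u. Qed.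

Lemma contact_xi_phi c p (cp : cdom c p) : xi c p *m phi c p = 0.
Proof. exact: xi_phi (acm_phi2 acm cp) (acm_eta_xi acm cp). Qed.

Lemma ext_d_antisym c p (cp : cdom c p) u v :
  bil (ext_d eta c p) u v = - bil (ext_d eta c p) v u.
Proof. exact: bil_N_antisym (ext_d_nabla acm lc cp) u v. Qed.

Lemma ext_d_nondegenerate c p (cp : cdom c p) u : ev (eta c p) u = 0 ->
  (forall v, ev (eta c p) v = 0 -> bil (ext_d eta c p) u v = 0) -> u = 0.
Proof.
have [_ [m [dm /(_ c p cp)[v wv]]]] := cf.
apply: wedge_covector_nondegenerate wv; first by rewrite dm addnC mulnC.
exact: ext_d_antisym.
Qed.

Definition contact_mx : @matrices R d M := fun c p =>
  skew_mx (g c p) (xi c p) (eta c p) (nabla xi c p).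

Definition contact_ext_mx : @matrices R d M := fun c p =>
  skew_ext_mx (g c p) (xi c p) (eta c p) (nabla xi c p).

Lemma contact_BE c p u : cdom c p -> ev (eta c p) u = 0 ->
  contact_B eta g nabla xi c p u = u *m contact_mx c p.
Proof.
move=> cp u0; rewrite /contact_B /skew_part.
set A := nabla xi c p; set Q := 1%:M - eta c p *m xi c p.
have -> : adjoint_on (contact_dist eta) g
      (fun c p u => u *m nabla xi c p) c p u =
    u *m metric_adjoint g (nabla xi) c p *m Q.
  have adjP w : ev (eta c p) w = 0 ->
      bil (g c p) (u *m metric_adjoint g (nabla xi) c p *m Q) w =
      bil (g c p) u (w *m A).
    move=> w0; rewrite (bil_horizontal (acm_phi2 acm cp) (acm_eta_xi acm cp)
      (acm_g_phi acm cp) (acm_g_sym acm cp)) //.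
    exact: bil_adjoint (acm_g_pos acm cp) _ _ _.
  have Q0 w : ev (eta c p) (w *m Q) = 0.
    exact: ev_horizontal (acm_eta_xi acm cp) w.
  apply: xget_unique => [|w [Dw wP]]; first by split.
  apply: (horizontal_inj (acm_g_pos acm cp) (eta := eta c p)) => //.
  by move=> v v0; rewrite wP // adjP.
(* Since nabla_u xi is already horizontal, [Q] can be factored out of the difference. *)
have uA : u *m A *m Q = u *m A.
  exact: (horizontal_id (xi c p) (nabla_xi_horizontal acm lc cp u)).
by rewrite -{1}uA -mulmxBl -mulmxBr -mulmxA scalemxAr.
Qed.

Lemma contact_mx_horizontal c p (cp : cdom c p) u :
  ev (eta c p) (u *m contact_mx c p) = 0.
Proof. exact: skew_mx_horizontal (acm_eta_xi acm cp) _ u. Qed.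

Lemma contact_ext_mxE c p u : ev (eta c p) u = 0 ->
  u *m contact_ext_mx c p = u *m contact_mx c p.
Proof. exact: skew_ext_id. Qed.

Lemma ev_contact_ext_mx c p (cp : cdom c p) u :
  ev (eta c p) (u *m contact_ext_mx c p) = ev (eta c p) u.
Proof. exact: ev_skew_ext (acm_eta_xi acm cp) _ u. Qed.

Lemma contact_ext_unitmx c p (cp : cdom c p) : contact_ext_mx c p \in unitmx.
Proof.
have unit := skew_ext_unitmx (acm_phi2 acm cp) (acm_eta_xi acm cp)
  (acm_g_phi acm cp) (acm_g_sym acm cp) (acm_g_pos acm cp)
  (ext_d_nabla acm lc cp).
exact: unit (ext_d_nondegenerate cp).
Qed.

Lemma contact_mx_tensor : tensor11 setT contact_mx.
Proof.
have [[_ xiT etaT gT] _] := acm.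
apply: tensor11Z; first exact: openT.
apply: tensor11M; first exact: openT.
  apply: tensor11B; first exact: openT.
    exact: (nabla_xi_tensor acm lc).
  apply: tensor11_metric_adjoint => //; first exact: openT.
  exact: (nabla_xi_tensor acm lc).
apply: tensor11B; [exact: openT|exact: tensor11_id|].
by apply: tensor11_outer => //; exact: openT.
Qed.

Lemma contact_ext_mx_tensor : tensor11 setT contact_ext_mx.
Proof.
have [[_ xiT etaT gT] _] := acm.
have out : tensor11 setT (fun c p => eta c p *m xi c p).
  by apply: tensor11_outer => //; exact: openT.
apply: tensor11D; [exact: openT| |exact: out].
apply: tensor11M; [exact: openT| |exact: contact_mx_tensor].
by apply: tensor11B; [exact: openT|exact: tensor11_id|].
Qed.

(** A tensor field preserving D passes its chart law and smoothness on to any fibre map that agrees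
    with it on D. *)
Lemma tensor_bundle_endomorphism (D : chart M -> M -> set 'rV[R]_d)
    (B : fibre_map) (F : @matrices R d M) :
  tensor11 setT F ->
  (forall c p (a : R) u v, cdom c p -> D c p u -> D c p v ->
     D c p (a *: u + v)) ->
  (forall c c' p u, cdom c p -> cdom c' p -> D c p u ->
     D c' p (u *m jac c c' p)) ->
  (forall c p u, cdom c p -> D c p u -> B c p u = u *m F c p) ->
  (forall c p u, cdom c p -> D c p u -> D c p (u *m F c p)) ->
  bundle_endomorphism D B.
Proof.
move=> [FJ FS] Dlin Djac BE DF; split.
- by move=> c p u cp Du; rewrite BE //; exact: DF.
- move=> c p a u v cp Du Dv; rewrite !BE //; last exact: Dlin.
  by rewrite mulmxDl -scalemxAl.
- move=> c c' p u cp c'p Du; rewrite !BE //; last exact: Djac.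
  by rewrite -!mulmxA FJ.
- move=> W X oW XW XD.
  apply: (@eq_vector_field _ _ _ _ (fun c p => X c p *m F c p)) => //.
    by move=> c p Wp cp; rewrite BE //; exact: XD.
  by apply: vector_field_mul => //; apply: tensor11_sub (conj FJ FS).
Qed.

Lemma contact_B_automorphism :
  bundle_automorphism (contact_dist eta) (contact_B eta g nabla xi).
Proof.
have [[_ _ [etaJ _] _] _] := acm.
have Dlin c p (a : R) u v : cdom c p -> contact_dist eta c p u ->
    contact_dist eta c p v -> contact_dist eta c p (a *: u + v).
  by rewrite /contact_dist /= ev_linear => _ -> ->; rewrite mulr0 addr0.
have Djac c c' p u : cdom c p -> cdom c' p -> contact_dist eta c p u ->
    contact_dist eta c' p (u *m jac c c' p).
  move=> cp c'p; rewrite /contact_dist /= (etaJ c c') //.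
  by rewrite /ev mulmxA.
have invD c p u : cdom c p -> contact_dist eta c p u ->
    contact_dist eta c p (u *m invmx (contact_ext_mx c p)).
  move=> cp; rewrite /contact_dist /= => u0.
  by rewrite -ev_contact_ext_mx // mulmxKV // contact_ext_unitmx.
split.
  apply: (tensor_bundle_endomorphism contact_mx_tensor) => //.
    by move=> c p u; exact: contact_BE.
  by move=> c p u cp _; exact: contact_mx_horizontal.
exists (fun c p u => u *m invmx (contact_ext_mx c p)); split.
  apply: (@tensor_bundle_endomorphism _ _
    (fun c p => invmx (contact_ext_mx c p))) => //.
  apply: tensor11V; [exact: openT| |exact: contact_ext_mx_tensor].
  by move=> c p _; exact: contact_ext_unitmx.
move=> c p u cp Du; split.
  by rewrite contact_BE // -contact_ext_mxE // mulmxK // contact_ext_unitmx.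
have Dw := invD c p u cp Du.
by rewrite contact_BE // -contact_ext_mxE // mulmxKV // contact_ext_unitmx.
Qed.

End ContactB.

Theorem proposition1 (R : realType) (d : nat) (M : manifold R d)
    (phi : @matrices R d M) (xi : @vectors R d M) (eta : @covectors R d M)
    (g : @matrices R d M) (nabla : @vectors R d M -> @matrices R d M) :
  (3 <= d)%N ->
  contact_form eta ->
  almost_contact_metric phi xi eta g ->
  levi_civita g nabla ->
  let D := contact_dist eta in
  let B := contact_B eta g nabla xi in
  let d_eta_anti_invariant :=
    forall c p, cdom c p -> forall u v, D c p u -> D c p v ->
      bil (ext_d eta c p) (u *m phi c p) (v *m phi c p)
      = - bil (ext_d eta c p) u v in
  let B_anticommutes :=
    forall c p, cdom c p -> forall u, D c p u ->
      B c p (u *m phi c p) + B c p u *m phi c p = 0 in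
  (d_eta_anti_invariant <-> B_anticommutes) /\
  (d_eta_anti_invariant ->
     (exists n : nat, (1 <= n)%N /\ d = (4 * n + 1)%N) /\
     bundle_automorphism D B).
Proof.
move=> d3 cf acm lc D B anti anticomm.
have phi0 c p (cp : cdom c p) u : ev (eta c p) (u *m phi c p) = 0.
  exact: (contact_eta_phi acm).
have pointwise c p : cdom c p ->
    (forall u v, D c p u -> D c p v ->
       bil (ext_d eta c p) (u *m phi c p) (v *m phi c p) =
       - bil (ext_d eta c p) u v) <->
    (forall u, D c p u -> B c p (u *m phi c p) + B c p u *m phi c p = 0).
  move=> cp.
  have BE : (forall u, D c p u ->
        B c p (u *m phi c p) + B c p u *m phi c p = 0) <->
      (forall u, D c p u ->
        u *m phi c p *m contact_mx xi eta g nabla c p +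
        u *m contact_mx xi eta g nabla c p *m phi c p = 0).
    by split=> BP u Du; have := BP u Du; rewrite /B !(contact_BE acm lc) //;
      exact: phi0.
  apply: iff_trans (iff_sym BE).
  have iffP := anti_invariantP (acm_phi2 acm cp) (acm_eta_xi acm cp)
    (acm_g_phi acm cp) (acm_g_sym acm cp) (acm_g_pos acm cp).
  exact: iffP (ext_d_nabla acm lc cp).
split.
  by split=> H c p cp; have := H c p cp; apply pointwise.
move=> danti; split; last exact: (contact_B_automorphism acm lc cf).
(* The dimension can be read off at any one point. *)
have [p _] := manifold_nonempty M; have [c cp] := cdom_cover p.
have [n dn] := dim_anti_invariant (acm_phi2 acm cp) (acm_eta_xi acm cp)
  (contact_xi_phi acm cp) (phi0 _ _ cp) (ext_d_antisym acm lc cp)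
  (danti c p cp) (ext_d_nondegenerate acm lc cf cp).
(* The bound 3 <= d excludes n = 0, which would give d = 1. *)
by exists n; split=> //; case: n dn d3 => // ->.
Qed.
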